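(* Let $n\ge2$, $k\in\{1,\dots,n-1\}$. The rational maps $\Theta_{n-k}^{-1}\circ S\circ\Theta_{n-k}:\mathbb T_k\to\mathbb T_k$ and $\Theta_k^{-1}\circ D\circ\Theta_{n-k}:\mathbb T_k\to\mathbb T_{n-k}$ have subtraction-free components; let $\widehat S$ and $\widehat D$ be their tropicalizations. Then on the set $B^k$ of $k$-rectangles, $\widehat S=\widetilde{\mathrm{rot}}$ and $\widehat D=\widetilde{\mathrm{refl}}$.
   Context: Notation: $[i,j]=\{m\in\mathbb Z:i\le m\le j\}$, $[n]=[1,n]$, $E_{ij}$ matrix units. For $r\in[n-1]$, $\mathcal X_r=\mathrm{Gr}(r,n)\times\mathbb C^\times$; points of $\mathrm{Gr}(r,n)$ are column spans of full-rank $n\times r$ matrices; $P_J(M)$ is the maximal minor on rows $J$; for a finite set $I$ of integers $P_I(M)=P_{I'}(M)$ with $I'$ the residues mod $n$ in $[n]$, and $P_{I'}=0$ if $|I'|\ne r$. $g^r(M,t)$ is the $n\times n$ matrix over $\mathbb C[\lambda]$ with $A_{ij}=c_{ij}\frac{P_{[j-r+1,j-1]\cup\{i\}}(M)}{P_{[j-r,j-1]}(M)}$, $c_{ij}=1$ if $j\le r$, $t$ if $j>r$ and $i\ge j$, $\lambda$ if $j>r$ and $i<j$. $\mathrm{fl}(A)_{ij}=A_{n-j+1,n-i+1}$. $S:\mathcal X_r\to\mathcal X_r$, $S(M,t)=(S_t(M),t)$, with $S_t(M)$ the column span of the first $r$ columns of $\mathrm{fl}(g^r(M,t))|_{\lambda=(-1)^{r-1}t}$.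 $M^\perp$ is the orthogonal complement w.r.t. $\langle v_i,v_j\rangle=(-1)^{i+1}\delta_{ij}$; $T_{w_0}(M)=Q_{w_0}\cdot M$ with $Q_{w_0}$ the antidiagonal permutation matrix; $D:\mathcal X_r\to\mathcal X_{n-r}$, $D(M,t)=S(T_{w_0}(M^\perp),t)$. Parametrization: for $m\in[n-1]$, $R_m=\{(i,j):1\le i\le m,\ i\le j\le i+n-m-1\}$, $\mathbb T_m=(\mathbb C^\times)^{R_m}\times\mathbb C^\times$. With $x_{-i}(c)=cE_{ii}+c^{-1}E_{i+1,i+1}+E_{i+1,i}+\sum_{j\ne i,i+1}E_{jj}$, $t_i(c)=cE_{ii}+\sum_{j\ne i}E_{jj}$, $M_{[i,j]}(c_i,\dots,c_j)=x_{-i}(c_i)\cdots x_{-(j-1)}(c_{j-1})t_j(c_j)$, let $\Phi_m(X_{ij},t)=\prod_{i=m}^{1}M_{[i,i+n-m]}(X_{ii},\dots,X_{i,i+n-m-1},t)$ (decreasing $i$ left to right) and $\Theta_{n-m}:\mathbb T_m\to\mathcal X_{n-m}$, $\Theta_{n-m}(X_{ij},t)=(\text{span of first }n-m\text{ columns of }\Phi_m(X_{ij},t),\,t)$, a birational isomorphism. Tropicalization: for subtraction-free rational functions (ratios of polynomials with nonnegative integer coefficients), replace $+,\times,\div$ by $\min,+,-$ and positive constants by $0$, with $X_{ij}\mapsto B_{ij}$, $t\mapsto L$; componentwise for tuples. Thus $\widehat S:\mathbb Z^{R_k}\times\mathbb Z\to\mathbb Z^{R_k}\times\mathbb Z$ and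 $\widehat D:\mathbb Z^{R_k}\times\mathbb Z\to\mathbb Z^{R_{n-k}}\times\mathbb Z$. $k$-rectangles: $b=(B_{ij},L)\in\mathbb Z^{R_k}\times\mathbb Z$ with array $A_{ij}=B_{ij}$ on $R_k$, $A_{ij}=L$ for $j>i+n-k-1$ ($1\le i\le j\le n$), is a $k$-rectangle if all $A_{ij}\ge0$ and $A_{i,j+1}\ge A_{ij}\ge A_{i+1,j+1}$ for $1\le i\le j\le n-1$; $B^k$ is their set. $\widetilde{\mathrm{rot}}(B_{ij},L)=(L-B_{k-i+1,n-j},\,L)$ for $(i,j)\in R_k$; $\widetilde{\mathrm{refl}}(B_{ij},L)=(L-B_{j-i+1,j},\,L)$ for $(i,j)\in R_{n-k}$. *)

(* Defs.v *)
From HB Require Import structures.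
From mathcomp Require Import all_boot all_order all_algebra.
From mathcomp Require Import fraction.
From mathcomp Require Import complex reals.
From mathcomp Require Import mpoly.

Set Implicit Arguments.
Unset Strict Implicit.
Unset Printing Implicit Defensive.

Import Order.TTheory GRing.Theory Num.Theory.
Local Open Scope ring_scope.

(* Conventions. All indices are 1-based, as in the mathematical text: the row  *)
(* or column numbered i is the ordinal whose value is i - 1.                   *)

Section Grassmannian.

Variables (F : fieldType) (n : nat).

Local Notation V := 'cV[F]_n.

(* A point of Gr(r, n) x F^* is a pair (M, t) with \dim M = r and t != 0.      *)
Definition in_grass (r : nat) (u : {vspace V} * F) : bool :=
  (\dim u.1 == r) && (u.2 != 0).

Definition span_cols (r : nat) (A : 'M[F]_n) : {vspace V} :=
  <<[seq col j A | j : 'I_n <- enum 'I_n & (j < r)%N]>>%VS.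

(* A full-rank n x r matrix with column span M, when \dim M = r. Only ratios   *)
(* of its maximal minors are used, and these do not depend on the basis.       *)
Definition frame (r : nat) (M : {vspace V}) : 'M[F]_(n, r) :=
  \matrix_(i, j) ((vbasis M)`_j : V) i 0.

Definition intervalz (a b : int) : seq int :=
  if a <= b then [seq a + d%:Z | d <- iota 0 `|b - a|.+1] else [::].

Definition residues (I : seq int) : {set 'I_n} :=
  [set x : 'I_n | has (fun i => (i == x.+1%:Z %[mod n])%Z) I].

Definition plucker (r : nat) (M : {vspace V}) (I : seq int) : F :=
  let J := residues I in
  if #|J| == r then
    \det (\matrix_(a < r, b < r) [seq frame r M i b | i <- enum J]`_a)
  else 0.

(* The indeterminate 'X of {poly F} is lambda.                                 *)
Definition gmat (r : nat) (M : {vspace V}) (t : F) : 'M[{poly F}]_n :=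
  \matrix_(a, b)
    let i := a.+1 in let j := b.+1 in
    let c : {poly F} :=
      if (j <= r)%N then 1 else if (j <= i)%N then t%:P else 'X in
    c * (plucker r M (rcons (intervalz (j%:Z - r%:Z + 1) (j%:Z - 1)) i%:Z)
         / plucker r M (intervalz (j%:Z - r%:Z) (j%:Z - 1)))%:P.

Definition fl (K : Type) (A : 'M[K]_n) : 'M[K]_n :=
  \matrix_(i, j) A (rev_ord j) (rev_ord i).

Definition S_space (r : nat) (M : {vspace V}) (t : F) : {vspace V} :=
  span_cols r (map_mx (horner_eval ((-1) ^+ r.-1 * t)) (fl (gmat r M t))).

(* The graph of the rational map S : X_r --> X_r, over the open set where the  *)
(* denominators of g^r do not vanish and the image has dimension r.            *)
Definition S_graph (r : nat) (u v : {vspace V} * F) : Prop :=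
  [/\ in_grass r u,
      forall j, (1 <= j <= n)%N ->
        plucker r u.1 (intervalz (j%:Z - r%:Z) (j%:Z - 1)) != 0,
      v = (S_space r u.1 u.2, u.2)
    & in_grass r v].

(* For 0-based i the sign (-1)^(i + 1) of the form becomes (-1)^i.             *)
Definition altform (u v : V) : F := \sum_(i < n) (-1) ^+ i * u i 0 * v i 0.

Definition perp (M : {vspace V}) : {vspace V} :=
  (\bigcap_(u <- vbasis M) lker (linfun (altform u : V -> F^o)))%VS.

Definition Tw0 (M : {vspace V}) : {vspace V} :=
  (linfun (mulmx (\matrix_(i, j) (i == rev_ord j)%:R : 'M[F]_n) : V -> V)
    @: M)%VS.

(* The graph of the rational map D : X_r --> X_(n - r).                        *)
Definition D_graph (r : nat) (u v : {vspace V} * F) : Prop :=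
  in_grass r u /\ S_graph (n - r) (Tw0 (perp u.1), u.2) v.

Lemma perpP (M : {vspace V}) (v : V) :
  reflect (forall u, u \in M -> altform u v = 0) (v \in perp M).
Proof.
have linr u : linear (altform u : V -> F^o).
  move=> a x y; rewrite /altform scaler_sumr -big_split /=.
  by apply: eq_bigr => i _; rewrite !mxE mulrDr mulrCA.
have kerE u : (v \in lker (linfun (altform u : V -> F^o))) = (altform u v == 0).
  pose h := GRing.isLinear.Build _ _ _ _ (altform u : V -> F^o) (linr u).
  pose f : {linear V -> F^o} := HB.pack (altform u : V -> F^o) h.
  by rewrite memv_ker -[linfun _]/(linfun f) lfunE.
have mem_cap (s : seq V) :
    (v \in \bigcap_(u <- s) lker (linfun (altform u : V -> F^o)))%VS
    = all (fun u => altform u v == 0) s.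
  elim: s => [|u s IHs] /=; first by rewrite big_nil memvf.
  by rewrite big_cons memv_cap kerE IHs.
rewrite /perp mem_cap; apply: (iffP allP) => [h u uM | h u /vbasis_mem uM].
  rewrite (coord_vbasis uM) /altform.
  under eq_bigr => i _ do
    rewrite summxE mulr_sumr mulr_suml.
  rewrite exchange_big big1 //= => j _.
  under eq_bigr => i _ do rewrite mxE mulrCA -mulrA.
  rewrite -mulr_sumr; apply/eqP; rewrite mulf_eq0; apply/orP; right.
  exact/h/mem_nth/(leq_trans (ltn_ord j))/eq_leq/esym/size_tuple.
exact/eqP/h.
Qed.

End Grassmannian.

Section Parametrization.

Variables n m : nat.

Definition in_R (i j : nat) : bool :=
  [&& 1 <= i, i <= m, i <= j & j <= i + (n - m) - 1]%N.

(* Both coordinates of an element of R_m are at most n - 1.                    *)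
Definition Rset : Type := {p : 'I_n * 'I_n | in_R p.1 p.2}.

Definition fst_R (p : Rset) : nat := (val p).1.
Definition snd_R (p : Rset) : nat := (val p).2.

(* T^(R_m) x T: points of the torus, lattice points, tuples of functions.      *)
Definition rpoint (T : Type) : Type := ({ffun Rset -> T} * T)%type.

Definition entry (T : zmodType) (x : rpoint T) (i j : nat) : T :=
  if [pick p : Rset | (fst_R p == i) && (snd_R p == j)] is Some p
  then x.1 p else 0.

(* None is the index of the last coordinate (t or L).                          *)
Definition coord_at (T : Type) (x : rpoint T) (v : option Rset) : T :=
  if v is Some p then x.1 p else x.2.

Definition in_torus (F : fieldType) (x : rpoint F) : Prop :=
  forall v, coord_at x v != 0.

Definition nvars : nat := #|{: option Rset}|.

Definition coords (T : Type) (x : rpoint T) (a : 'I_nvars) : T :=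
  coord_at x (enum_val a).

End Parametrization.

Section Theta.

Variables (F : fieldType) (n : nat).

Definition Emx (i j : nat) : 'M[F]_n :=
  \matrix_(a, b) ((a.+1 == i) && (b.+1 == j))%:R.

Definition xminus (i : nat) (c : F) : 'M[F]_n :=
  c *: Emx i i + c^-1 *: Emx i.+1 i.+1 + Emx i.+1 i
  + \sum_(1 <= j < n.+1 | (j != i) && (j != i.+1)) Emx j j.

Definition tdiag (i : nat) (c : F) : 'M[F]_n :=
  c *: Emx i i + \sum_(1 <= j < n.+1 | j != i) Emx j j.

(* M_[i, j](c_i, ..., c_j)                                                     *)
Definition Mint (i j : nat) (c : nat -> F) : 'M[F]_n :=
  (\prod_(i <= l < j) xminus l (c l)) *m tdiag j (c j).

Definition Phi (m : nat) (x : rpoint n m F) : 'M[F]_n :=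
  \prod_(i <- rev (index_iota 1 m.+1))
    Mint i (i + n - m)
      (fun l => if l == (i + n - m)%N then x.2 else entry x i l).

(* Theta_(n - m) : T_m -> X_(n - m)                                            *)
Definition Theta (m : nat) (x : rpoint n m F) : {vspace 'cV[F]_n} * F :=
  (span_cols (n - m) (Phi x), x.2).

End Theta.

Section RationalMaps.

Variables (F : fieldType) (n k m : nat).

(* Rational functions on T_k.                                                  *)
Definition ratfun : Type := {fraction {mpoly F[nvars n k]}}.

Definition has_value (f : ratfun) (x : rpoint n k F) (y : F) : Prop :=
  exists p q : {mpoly F[nvars n k]},
    [/\ f = (tofrac p / tofrac q : {fraction {mpoly F[nvars n k]}}),
        q.@[coords x] != 0 & y = p.@[coords x] / q.@[coords x]].

(* phi, given by its components, is the rational map T_k --> T_m whose graph   *)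
(* over some dense Zariski-open subset of T_k is contained in G.               *)
Definition rational_map_of
    (phi : rpoint n m ratfun) (G : rpoint n k F -> rpoint n m F -> Prop) : Prop :=
  exists2 h : {mpoly F[nvars n k]}, h != 0 &
    forall x : rpoint n k F, in_torus x -> h.@[coords x] != 0 ->
      exists y : rpoint n m F,
        [/\ in_torus y,
            forall v, has_value (coord_at phi v) x (coord_at y v)
          & G x y].

Definition nonneg_poly (N : nat) (p : {mpoly int[N]}) : Prop :=
  p != 0 /\ forall e, 0 <= p@_e.

(* The tropical value of a nonzero polynomial with nonnegative coefficients:   *)
(* the minimum of e . b over its monomials X^e, of which mlead p is one.       *)
Definition trop_poly (N : nat) (p : {mpoly int[N]}) (b : 'I_N -> int) : int :=
  let val_at (e : 'X_{1..N}) := \sum_(a < N) b a *+ e a in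
  \big[Order.min/val_at (mlead p)]_(e <- msupp p) val_at e.

Definition ratio_of (f : ratfun) (p q : {mpoly int[nvars n k]}) : Prop :=
  f = (tofrac (map_mpoly intr p) / tofrac (map_mpoly intr q)
        : {fraction {mpoly F[nvars n k]}}).

Definition subtraction_free (f : ratfun) : Prop :=
  exists p q, [/\ nonneg_poly p, nonneg_poly q & ratio_of f p q].

Definition is_trop (f : ratfun) (g : rpoint n k int -> int) : Prop :=
  exists p q, [/\ nonneg_poly p, nonneg_poly q, ratio_of f p q
    & forall b, g b = trop_poly p (coords b) - trop_poly q (coords b)].

Definition is_tropicalization
    (phi : rpoint n m ratfun) (Phat : rpoint n k int -> rpoint n m int) : Prop :=
  forall v, is_trop (coord_at phi v) (fun b => coord_at (Phat b) v).

End RationalMaps.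

(* Theta^-1 o S o Theta and Theta^-1 o D o Theta; applying Theta^-1 to a point *)
(* of its image is taking the y in the torus with that image.                  *)
Definition S_conj_graph (F : fieldType) (n k : nat) (x y : rpoint n k F) : Prop :=
  S_graph (n - k) (Theta x) (Theta y).

Definition D_conj_graph (F : fieldType) (n k : nat)
    (x : rpoint n k F) (y : rpoint n (n - k) F) : Prop :=
  D_graph (n - k) (Theta x) (Theta y).

Section Rectangles.

Variables n k : nat.

(* The rows i > k, on which neither B_ij nor L is prescribed, are zero, as for *)
(* a Gelfand-Tsetlin pattern of rectangular shape with k rows.                 *)
Definition rect_array (b : rpoint n k int) (i j : nat) : int :=
  if in_R n k i j then entry b i j
  else if (i + (n - k) - 1 < j)%N then b.2 else 0.

Definition k_rectangle (b : rpoint n k int) : Prop :=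
  (forall i j, (1 <= i)%N -> (i <= j)%N -> (j <= n)%N -> 0 <= rect_array b i j)
  /\ (forall i j, (1 <= i)%N -> (i <= j)%N -> (j <= n - 1)%N ->
        rect_array b i j <= rect_array b i j.+1 /\
        rect_array b i.+1 j.+1 <= rect_array b i j).

Definition rot_tilde (b : rpoint n k int) : rpoint n k int :=
  ([ffun p => b.2 - entry b (k - fst_R p + 1) (n - snd_R p)], b.2).

Definition refl_tilde (b : rpoint n k int) : rpoint n (n - k) int :=
  ([ffun p => b.2 - entry b (snd_R p - fst_R p + 1) (snd_R p)], b.2).

End Rectangles.

(* Main.v *)
(** Write r = n - k. Each factor M_[i,j](c) is lower bidiagonal, with diagonal
    c_i, c_(i+1)/c_i, ..., c_j/c_(j-1) and ones below it. Hence Phi(x) is lower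
    triangular of bandwidth k, and in fact Phi(x) is g^r(Theta(x)) at
    lambda = 0: column j of g^r is characterized, up to scalars, as the vector
    of the subspace that vanishes on the cyclic interval [j-r+1, j-1]. In the
    last r rows of g^r, the only ones used by S, the lambda-entries vanish, so S
    sends the column span of Phi(x) to that of fl(Phi(x)). As fl reverses
    products and flips each bidiagonal factor, fl(Phi(x)) = Phi(x') with
    x'_ij = t / x_(k-i+1,n-j) and the same t. For D, sign-twisted flips of the
    factors x_(-l)(c) are inverses of factors x_(-(n-l))(c); commuting distant
    factors gives T_w0(Theta(x)^perp) = Theta(z) with z_ab = x_(k+a-b,n-b), and
    applying S yields t / x_(j-i+1,j). Since Theta is injective on the torus,
    both conjugated maps are monomial, and their tropicalizations are linear. *)

Require Import Defs.
From HB Require Import structures.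
From mathcomp Require Import all_boot all_order all_algebra.
From mathcomp Require Import fraction complex reals mpoly.
From mathcomp Require Import zify ring.

Set Implicit Arguments.
Unset Strict Implicit.
Unset Printing Implicit Defensive.

Import Order.TTheory GRing.Theory Num.Theory.
Local Open Scope ring_scope.

(** * Monomial maps and their tropicalization *)

(** The lowest digit is the remainder modulo d, and induction gives the others. This makes the
    substitution below injective on the monomials of p. *)
Lemma radix_inj (N d : nat) (e e' : 'I_N -> nat) :
  (forall i, e i < d)%N -> (forall i, e' i < d)%N ->
  (\sum_(i < N) e i * d ^ i = \sum_(i < N) e' i * d ^ i)%N -> e =1 e'.
Proof.
elim: N e e' => [|N IH] e e' he he' heq; first by case.
have d0 : (0 < d)%N by apply: leq_ltn_trans (he ord0).
have S (f : 'I_N.+1 -> nat) : (\sum_(i < N.+1) f i * d ^ i =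
    (\sum_(i < N) f (lift ord0 i) * d ^ i) * d + f ord0)%N.
  rewrite big_ord_recl expn0 muln1 addnC big_distrl /=; congr (_ + _)%N.
  by apply: eq_bigr => i _; rewrite -mulnA -expnSr.
move: heq; rewrite !S => heq.
have h0 : e ord0 = e' ord0.
  by have := congr1 (modn^~ d) heq; rewrite !modnMDl !modn_small.
have hl : (fun i => e (lift ord0 i)) =1 (fun i => e' (lift ord0 i)).
  apply: IH => // .
  by apply/eqP; rewrite -(eqn_pmul2r d0) -(eqn_add2r (e ord0)) {2}h0; apply/eqP.
by move=> i; case: (unliftP ord0 i) => [j ->|->] //; apply: hl.
Qed.

(* Kronecker substitution: X_i := c^(d^i) separates the monomials of p. *)
Lemma mpoly_nonroot (F : numFieldType) (N : nat) (p : {mpoly F[N]}) :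
  p != 0 -> exists v : 'I_N -> F, p.@[v] != 0.
Proof.
move=> p0; pose d := msize p.
pose wt (m : 'X_{1..N}) := (\sum_(i < N) m i * d ^ i)%N.
pose q : {poly F} := \sum_(m <- msupp p) p@_m *: 'X^(wt m).
have small m : m \in msupp p -> forall i, (m i < d)%N.
  move=> hm i; apply: leq_ltn_trans (msize_mdeg_lt hm).
  by rewrite mdegE (bigD1 i) // leq_addr.
have wt_inj : {in msupp p &, injective wt}.
  move=> m m' /small hm /small hm' heq; apply/mnmP.
  exact: radix_inj hm hm' heq.
have q0 : q != 0.
  have hl := mlead_supp p0.
  apply/eqP => /(congr1 (fun q : {poly F} => q`_(wt (mlead p)))).
  rewrite coef0 /q coef_sum (bigD1_seq _ hl (msupp_uniq p)) /=.
  rewrite coefZ coefXn eqxx mulr1 big_seq_cond big1 ?addr0; last first.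
    move=> m /andP[hm hne]; rewrite coefZ coefXn.
    case: eqP => [/esym/(wt_inj _ _ hm hl) E|_]; last by rewrite mulr0.
    by rewrite E eqxx in hne.
  by move/eqP; rewrite mcoeff_eq0 hl.
(* In characteristic zero the naturals below [size q] are distinct, and they are one too many to be
   all roots of q. *)
have [c hc] : exists c : F, q.[c] != 0.
  have [/allP h|/allPn[x _ hx]] :=
    boolP (all (root q) [seq i%:R : F | i <- iota 0 (size q)]); last first.
    by exists x.
  have u : uniq [seq i%:R : F | i <- iota 0 (size q)].
    by rewrite map_inj_uniq ?iota_uniq // => i j /eqP; rewrite eqr_nat => /eqP.
  have := max_poly_roots q0 (introT allP h) u.
  by rewrite size_map size_iota ltnn.
exists (fun i : 'I_N => c ^+ (d ^ i)); move: hc; congr (_ != 0).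
rewrite /q horner_sum mevalE; apply: eq_bigr => m _.
rewrite hornerZ hornerXn; congr (_ * _).
rewrite /wt expr_sum; apply: eq_bigr => i _.
by rewrite mulnC exprM.
Qed.

Section Tropical.

Variable N : nat.

Definition trop_val (b : 'I_N -> int) (e : 'X_{1..N}) : int :=
  \sum_(a < N) b a *+ e a.

Lemma trop_poly_le (p : {mpoly int[N]}) b e :
  e \in msupp p -> trop_poly p b <= trop_val b e.
Proof. by move=> he; rewrite /trop_poly; apply: ge_bigmin_seq. Qed.

Lemma trop_poly_attained (p : {mpoly int[N]}) b :
  p != 0 -> exists2 e, e \in msupp p & trop_poly p b = trop_val b e.
Proof.
move=> /mlead_supp hl; rewrite /trop_poly big_seq.
elim/big_ind: _ => [|x y [e he ->] [e' he' ->]|e he].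
- by exists (mlead p).
- by case: leP => _; [exists e | exists e'].
- by exists e.
Qed.

(** Multiplication by a variable translates the support by a unit vector, so every candidate for the
    minimum grows by [b a]. This case of additivity suffices for monomial maps. *)
Lemma trop_polyMX (p : {mpoly int[N]}) (b : 'I_N -> int) (a : 'I_N) :
  p != 0 -> trop_poly (p * 'X_a) b = trop_poly p b + b a.
Proof.
move=> p0.
have valD e : trop_val b (U_(a) + e)%MM = trop_val b e + b a.
  rewrite /trop_val addrC [X in _ = X + _](_ : _ = \sum_i b i *+ (U_(a)%MM i)).
    by rewrite -big_split /=; apply: eq_bigr => i _; rewrite mnmDE mulrnDr.
  rewrite (bigD1 a) //= mnm1E eqxx mulr1n big1 ?addr0 // => i /negPf ne.
  by rewrite mnm1E eq_sym ne mulr0n.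
have q0 : p * 'X_a != 0.
  by rewrite mulf_neq0 // -msupp_eq0 msuppX.
have hs e : (e \in msupp (p * 'X_a)) = (e \in [seq (U_(a) + m)%MM | m <- msupp p]).
  by rewrite (perm_mem (msuppMX _ _)).
apply/eqP; rewrite eq_le; apply/andP; split.
  have [e he ->] := trop_poly_attained b p0.
  by rewrite -valD; apply: trop_poly_le; rewrite hs map_f.
have [e + ->] := trop_poly_attained b q0.
rewrite hs => /mapP[m hm ->].
by rewrite valD lerD2r trop_poly_le.
Qed.

End Tropical.

Section MonomialMap.

Variables (F : numFieldType) (n k m : nat) (iota : Rset n m -> Rset n k).

(** Both conjugated maps will turn out to have this shape, for suitable reindexings [iota]. *)
Definition monomial_map (x : rpoint n k F) : rpoint n m F :=
  ([ffun p => x.2 / x.1 (iota p)], x.2).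

Definition trop_monomial_map (b : rpoint n k int) : rpoint n m int :=
  ([ffun p => b.2 - b.1 (iota p)], b.2).

Let var (v : option (Rset n k)) : 'I_(nvars n k) := enum_rank v.

(** The coefficient ring is a parameter: over F the quotient [num / den] is the component itself,
    over the integers it is its subtraction-free representation. *)
Let num (v : option (Rset n m)) (A : nzRingType) : {mpoly A[nvars n k]} :=
  'X_(var None).
Let den (v : option (Rset n m)) (A : nzRingType) : {mpoly A[nvars n k]} :=
  if v is Some p then 'X_(var (Some (iota p))) else 1.

Lemma coords_var T (x : rpoint n k T) v : coords x (var v) = coord_at x v.
Proof. by rewrite /coords enum_rankK. Qed.

Definition point_of (T : Type) (v : 'I_(nvars n k) -> T) : rpoint n k T :=
  ([ffun p => v (var (Some p))], v (var None)).

Lemma coords_point_of T (v : 'I_(nvars n k) -> T) : coords (point_of v) =1 v.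
Proof.
move=> a; rewrite /coords -[in RHS](enum_valK a).
by case: (enum_val a) => [p|] //=; rewrite ffunE.
Qed.

Lemma mpolyX_neq0 (A : nzRingType) (N : nat) (a : 'I_N) : 'X_a != 0 :> {mpoly A[N]}.
Proof. by rewrite -msupp_eq0 msuppX. Qed.

Lemma den_neq0 v A : den v A != 0.
Proof. by case: v => [p|]; rewrite ?mpolyX_neq0 // oner_neq0. Qed.

Lemma num_meval v (x : rpoint n k F) : (num v F).@[coords x] = x.2.
Proof. by rewrite mevalXU coords_var. Qed.

Lemma den_meval v (x : rpoint n k F) :
  (den v F).@[coords x] = if v is Some p then x.1 (iota p) else 1.
Proof. by case: v => [p|] /=; rewrite ?mevalXU ?coords_var ?meval1. Qed.

Lemma monomial_mapE x v :
  coord_at (monomial_map x) v = (num v F).@[coords x] / (den v F).@[coords x].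
Proof.
rewrite num_meval den_meval; case: v => [p|] /=; last by rewrite divr1.
by rewrite ffunE.
Qed.

Lemma den_meval_neq0 v x : in_torus x -> (den v F).@[coords x] != 0.
Proof.
move=> hx; rewrite den_meval; case: v => [p|]; last exact: oner_neq0.
exact: (hx (Some (iota p))).
Qed.

Lemma num_map v : map_mpoly intr (num v int) = num v F.
Proof. by rewrite map_mpolyX. Qed.

Lemma den_map v : map_mpoly intr (den v int) = den v F.
Proof. by case: v => [p|]; rewrite /den ?map_mpolyX // rmorph1. Qed.

Lemma nonneg_mpolyX N (a : 'I_N) : nonneg_poly ('X_a : {mpoly int[N]}).
Proof. by split=> [|e]; rewrite ?mpolyX_neq0 // mcoeffX ler0n. Qed.

Lemma nonneg_num v : nonneg_poly (num v int).
Proof. exact: nonneg_mpolyX. Qed.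

Lemma nonneg_den v : nonneg_poly (den v int).
Proof.
case: v => [p|]; first exact: nonneg_mpolyX.
by split=> [|e]; rewrite ?oner_neq0 // mcoeff1 ler0n.
Qed.

Variable G : rpoint n k F -> rpoint n m F -> Prop.
Hypothesis G_mono : forall x, in_torus x -> G x (monomial_map x).
Hypothesis G_fun : forall x y, in_torus x -> in_torus y -> G x y ->
  y = monomial_map x.

Lemma monomial_map_torus x : in_torus x -> in_torus (monomial_map x).
Proof.
move=> hx [p|] /=; last exact: (hx None).
by rewrite ffunE mulf_neq0 ?invr_eq0 ?(hx None) ?(hx (Some (iota p))).
Qed.

Lemma monomial_map_rational :
  exists phi : rpoint n m (ratfun F n k), rational_map_of phi G.
Proof.
pose phi v : ratfun F n k := tofrac (num v F) / tofrac (den v F).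
(* The exceptional polynomial is 1, since the map is regular on the whole torus. *)
exists ([ffun p => phi (Some p)], phi None), 1; first exact: oner_neq0.
move=> x hx _; exists (monomial_map x); split.
- exact: monomial_map_torus.
- move=> v; exists (num v F), (den v F); split.
  + by case: v => [p|] //=; rewrite ffunE.
  + exact: den_meval_neq0.
  + exact: monomial_mapE.
- exact: G_mono.
Qed.

(** A rational function is determined by its values on a dense open set, and there [G_fun] forces
    the values of the monomial map. *)
Lemma rational_map_monomial (phi : rpoint n m (ratfun F n k)) v :
  rational_map_of phi G ->
  coord_at phi v = tofrac (num v F) / tofrac (den v F).
Proof.
move=> [h h0 hphi].
have val x : in_torus x -> h.@[coords x] != 0 ->
    has_value (coord_at phi v) x ((num v F).@[coords x] / (den v F).@[coords x]).
  move=> hx hh; have [y [hy hv /(G_fun hx hy) E]] := hphi x hx hh.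
  by rewrite -monomial_mapE -E.
(* Where T does not vanish no coordinate is zero, so nonroots of multiples of [h * T] are torus
   points at which the hypothesis applies. *)
pose T : {mpoly F[nvars n k]} := \prod_a 'X_a.
have T0 : T != 0 by apply/prodf_neq0 => a _; exact: mpolyX_neq0.
have torus u : T.@[u] != 0 -> in_torus (point_of u).
  rewrite /T rmorph_prod => /prodf_neq0 hu w.
  by have := hu (var w) isT; rewrite /= mevalXU -coords_var coords_point_of.
have good u : (h * T).@[u] != 0 ->
    in_torus (point_of u) /\ h.@[coords (point_of u)] != 0.
  rewrite mevalM mulf_eq0 negb_or => /andP[hh /torus ht]; split=> //.
  by rewrite (meval_eq _ (coords_point_of u)).
have [u0 /good [t0 hh0]] := mpoly_nonroot (mulf_neq0 h0 T0).
(* One representation of the component is fixed here. [has_value] may supply another one at each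
   point; the two are compared by cross-multiplication. *)
have [p1 [q1 [E1 q1x _]]] := val _ t0 hh0.
have q1_0 : q1 != 0 by apply: contraNneq q1x => ->; rewrite meval0.
have D0 := den_neq0 v F.
suff E : p1 * den v F = num v F * q1.
  rewrite E1; apply/eqP; rewrite eqr_div ?tofrac_eq0 //.
  by rewrite -!tofracM E mulrC.
apply/eqP; rewrite -subr_eq0; apply/negPn/negP => ne.
have [u] := mpoly_nonroot (mulf_neq0 ne (mulf_neq0 h0 T0)).
rewrite mevalM mulf_eq0 negb_or => /andP[/eqP + /good [tu hu]]; apply.
have [p [q [E qx Eq]]] := val _ tu hu.
have q0 : q != 0 by apply: contraNneq qx => ->; rewrite meval0.
have pq : p1 * q = p * q1.
  move: E; rewrite E1 => /eqP; rewrite eqr_div ?tofrac_eq0 // -!tofracM tofrac_eq.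
  by move/eqP.
have Dx := den_meval_neq0 v tu.
move/eqP: Eq; rewrite eqr_div // => /eqP Eq.
have := congr1 (meval (coords (point_of u))) pq; rewrite !mevalM => Epq.
rewrite -(meval_eq _ (coords_point_of u)) mevalB !mevalM.
apply: (mulIf qx); rewrite mul0r mulrBl mulrAC Epq.
by rewrite [X in _ - X]mulrAC Eq; ring.
Qed.

Lemma map_mpoly_intr_inj N : injective (@map_mpoly N int F intr).
Proof.
move=> p q E; apply/mpolyP => e.
have := congr1 (mcoeff e) E; rewrite !mcoeff_map_mpoly.
by move/eqP; rewrite eqr_int => /eqP.
Qed.

(** Both sides of the polynomial identity are tropicalized, so the difference does not depend on the
    representation p / q. *)
Lemma trop_num_den v (p q : {mpoly int[nvars n k]}) b :
  p != 0 -> q != 0 -> p * den v int = q * num v int ->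
  trop_poly p (coords b) - trop_poly q (coords b)
    = coord_at (trop_monomial_map b) v.
Proof.
move=> p0 q0 E.
have := congr1 (fun s => trop_poly s (coords b)) E.
rewrite /= trop_polyMX // coords_var.
case: v E => [w|] _ /=; last by rewrite mulr1 => ->; rewrite addrC addKr.
by rewrite trop_polyMX // coords_var ffunE /= => h; lia.
Qed.

(** This isolates the tropical half of the argument: what is left for linear algebra is to show
    that, on the torus, the graph G is that of a monomial map. *)
Theorem monomial_map_trop :
  (exists phi : rpoint n m (ratfun F n k), rational_map_of phi G)
  /\ (forall phi : rpoint n m (ratfun F n k), rational_map_of phi G ->
       (forall v, subtraction_free (coord_at phi v))
       /\ (forall Phat, is_tropicalization phi Phat ->
             forall b, Phat b = trop_monomial_map b)).
Proof.
split; first exact: monomial_map_rational.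
move=> phi hphi; split.
  move=> v; exists (num v int), (den v int); split.
  - exact: nonneg_num.
  - exact: nonneg_den.
  - by rewrite /ratio_of num_map den_map; apply: rational_map_monomial.
move=> Phat hP b.
have coordE v : coord_at (Phat b) v = coord_at (trop_monomial_map b) v.
  have [p [q [[p0 _] [q0 _] hr ->]]] := hP v.
  (* The integer identity is verified over F, where it is the equality of two fractions for the same
     component. *)
  apply: trop_num_den => //; apply: map_mpoly_intr_inj.
  rewrite !rmorphM /= num_map den_map.
  move: hr; rewrite /ratio_of (rational_map_monomial v hphi) => /eqP.
  have inj0 (s : {mpoly int[nvars n k]}) :
      s != 0 -> map_mpoly intr s != 0 :> {mpoly F[_]}.
    apply: contraNneq => /eqP; rewrite -(rmorph0 (map_mpoly intr)) => /eqP.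
    by move/map_mpoly_intr_inj ->.
  rewrite eqr_div ?tofrac_eq0 ?den_neq0 ?inj0 // -!tofracM tofrac_eq => /eqP.
  by rewrite mulrC => <-; rewrite mulrC.
case: (Phat b) coordE => f l coordE; congr (_, _); last exact: (coordE None).
by apply/ffunP => p; have := coordE (Some p).
Qed.

End MonomialMap.

(** * Bidiagonal factors *)

Section Bidiagonal.

Variable F : fieldType.

(** Natural-number indices, 0-based, allow shifted positions such as a - 1 or b + m without building
    ordinals. *)
Definition mxf n (g : nat -> nat -> F) : 'M[F]_n := \matrix_(a, b) g a b.

Lemma eq_mxf n g g' :
  (forall a b, a < n -> b < n -> g a b = g' a b)%N -> mxf n g = mxf n g'.
Proof. by move=> h; apply/matrixP => a b; rewrite !mxE h. Qed.

Definition bidiag (d s : nat -> F) (a b : nat) : F :=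
  if a == b then d a else if a == b.+1 then s a else 0.

Lemma mul_bidiag n d s g :
  mxf n (bidiag d s) *m mxf n g =
  mxf n (fun a b => d a * g a b + (if a is a'.+1 then s a * g a' b else 0)).
Proof.
apply/matrixP => a b; rewrite !mxE (bigD1 a) //= !mxE /bidiag eqxx.
congr (_ + _).
case: a => [[|a] ha] /=.
  rewrite big1 // => j ne; rewrite !mxE /=.
  by case: ifP => [/eqP E|_]; [rewrite -val_eqE /= -E in ne|rewrite mul0r].
rewrite (bigD1 (Ordinal (ltnW ha))) //=; last by rewrite -val_eqE /= neq_ltn ltnSn.
rewrite !mxE /= eqxx gtn_eqF // big1 ?addr0 // => j /andP[n1 n2]; rewrite !mxE.
rewrite -!val_eqE /= in n1 n2.
by rewrite eq_sym (negPf n1) eqSS eq_sym (negPf n2) mul0r.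
Qed.

Lemma mxf1 n : 1%:M = mxf n (fun a b => (a == b)%:R).
Proof. by apply/matrixP => a b; rewrite !mxE. Qed.

Lemma xminusE n l c : (1 <= l < n)%N ->
  xminus n l c = mxf n
    (bidiag (fun a => if a.+1 == l then c else if a == l then c^-1 else 1)
            (fun a => (a == l)%:R)).
Proof.
move=> hl; apply/matrixP => a b; rewrite /xminus !mxE summxE.
rewrite (eq_bigr (fun j => (a.+1 == j)%:R * (b.+1 == j)%:R)); last first.
  by move=> j _; rewrite !mxE -natrM mulnb.
rewrite (eq_bigr (fun j => if j == a.+1 then (a == b :> nat)%:R else 0)); last first.
  move=> j _; rewrite eq_sym; case: eqP => [->|_]; last by rewrite mul0r.
  by rewrite mul1r eqSS eq_sym.
rewrite -big_mkcondr /=.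
have -> : \sum_(1 <= i < n.+1 | (i != l) && (i != l.+1) && (i == a.+1)) (a == b :> nat)%:R
   = (((a.+1 != l) && (a != l :> nat)) && (a == b :> nat))%:R :> F.
  rewrite big_mkcond (bigD1_seq a.+1) ?iota_uniq ?mem_index_iota ?ltnS ?ltn_ord //=.
  rewrite big1 ?addr0 => [|i /negPf ne]; last by rewrite ne andbF.
  by rewrite eqxx andbT !eqSS; case: ifP => // ->; rewrite andFb.
rewrite !eqSS /bidiag.
case E1: (a.+1 == l); case E2: (a == l :> nat); case E3: (b.+1 == l);
case E4: (b == l :> nat); case E5: (a == b :> nat); case E6: (a == b.+1 :> nat);
  by rewrite /= ?mulr1 ?mulr0 ?addr0 ?add0r //; lia.
Qed.

Lemma tdiagE n i c :
  tdiag n i c = mxf n (bidiag (fun a => if a.+1 == i then c else 1) (fun=> 0)).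
Proof.
apply/matrixP => a b; rewrite /tdiag !mxE summxE.
rewrite (eq_bigr (fun j => if j == a.+1 then (a == b :> nat)%:R else 0)); last first.
  move=> j _; rewrite !mxE [j == _]eq_sym; case: eqP => [<-|_] //=.
  by rewrite eqSS eq_sym.
rewrite big_mkcond (bigD1_seq a.+1) ?iota_uniq ?mem_index_iota ?ltnS ?ltn_ord //=.
rewrite eqxx big1 ?addr0 => [|j /negPf ->]; last by case: ifP.
rewrite /bidiag if_same.
case: (eqVneq a.+1 i) => [<-|_] /=; last by rewrite mulr0 add0r; case: ifP.
by rewrite addr0 eqSS eq_sym; case: ifP; rewrite ?mulr1 ?mulr0.
Qed.

Lemma mul_xminus n l c g : (1 <= l < n)%N ->
  xminus n l c *m mxf n g =
  mxf n (fun a b => if a.+1 == l then c * g a b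
                    else if a == l then g a.-1 b + c^-1 * g a b else g a b).
Proof.
move=> hl; rewrite xminusE // mul_bidiag; apply: eq_mxf => a b _ _.
case: eqP => [e1|n1].
  case: a e1 => [|a] e1 /=; rewrite ?addr0 //.
  by rewrite (_ : a.+1 == l = false) ?mul0r ?addr0 //; lia.
case: eqP => [e2|/eqP n2].
  case: a {n1} e2 => [|a] e2 /=; first by move: hl; rewrite -e2.
  by rewrite mul1r addrC.
case: a {n1} n2 => [|a] /= n2; first by rewrite mul1r addr0.
by rewrite mul0r addr0 mul1r.
Qed.

Lemma mul_tdiag n i c g :
  tdiag n i c *m mxf n g =
  mxf n (fun a b => if a.+1 == i then c * g a b else g a b).
Proof.
rewrite tdiagE mul_bidiag; apply: eq_mxf => a b _ _.
by case: a => [|a]; rewrite ?mul0r addr0; case: ifP; rewrite ?mul1r.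
Qed.

(** Induction on the length, peeling off the leftmost factor: it scales its first row by c_i,
    divides the next diagonal entry c_(i+1) by c_i, and adds to that next row a row that is still a
    unit vector. *)
Lemma MintE n i d c : (1 <= i)%N -> (i + d <= n)%N ->
  Mint n i (i + d) c =
  mxf n (bidiag (fun a => if a.+1 == i then c i
                          else if (i <= a < i + d)%N then c a.+1 / c a else 1)
                (fun a => (i <= a < i + d)%:R)).
Proof.
elim: d i => [|d IH] i h1 h2.
  rewrite /Mint addn0 big_geq // mul1mx tdiagE; apply: eq_mxf => a b _ _.
  by rewrite /bidiag (_ : (i <= a < i)%N = false) //; lia.
have := IH i.+1 isT; rewrite addSnnS => /(_ h2).
rewrite /Mint [in X in _ -> X]big_ltn; last by lia.
rewrite -mulmxE -mulmxA => ->; rewrite mul_xminus; last by lia.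
apply: eq_mxf => a b _ _; rewrite /bidiag.
case: eqP => [e1|n1].
  rewrite (_ : a.+1 == i.+1 = false); last by lia.
  rewrite (_ : (i < a < i + d.+1)%N = false); last by lia.
  rewrite (_ : (i <= a < i + d.+1)%N = false); last by lia.
  by case: ifP; rewrite ?mulr1 // ?if_same ?mulr0.
case: eqP => [e2|n2].
  rewrite -e2 eqxx ltnn /= (_ : a.-1.+1 == a.+1 = false); last by lia.
  rewrite (_ : (a < a.-1 < a + d.+1)%N = false); last by lia.
  rewrite leqnn /= (_ : a < a + d.+1)%N; last by lia.
  rewrite !if_same.
  have [e3|n3] := eqVneq a b.
    rewrite (_ : a.-1 == b = false); last by lia.
    by rewrite add0r mulrC.
  by rewrite mulr0 addr0 (_ : (a.-1 == b) = (a == b.+1)) //; lia.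
rewrite eqSS (_ : a == i = false); last by lia.
by rewrite (_ : (i < a < i + d.+1)%N = (i <= a < i + d.+1)%N) //; lia.
Qed.

End Bidiagonal.

(** * The matrix Phi *)

Section Stages.

Variables (F : fieldType) (r : nat) (E : nat -> nat -> F).
Hypothesis r_gt0 : (0 < r)%N.

(* [phi m] is the product of the first m bidiagonal factors of Phi, with       *)
(* 0-based row and column indices.                                             *)
Fixpoint phi (m : nat) (a b : nat) : F :=
  if m is m'.+1 then
    if (a < m')%N then phi m' a b
    else if a == m' then E m m * phi m' a b
    else if (a <= m' + r)%N then phi m' a.-1 b + E m a.+1 / E m a * phi m' a b
    else phi m' a b
  else (a == b)%:R.

Lemma rev_index_iotaS m :
  rev (index_iota 1 m.+2) = m.+1 :: rev (index_iota 1 m.+1).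
Proof.
rewrite /index_iota !subSS !subn0 -[X in iota 1 X]addn1 iotaD cats1 add1n.
by rewrite rev_rcons.
Qed.

Lemma prod_MintE n m : (m + r <= n)%N ->
  \prod_(i <- rev (index_iota 1 m.+1)) Mint n i (i + r) (E i) = mxf n (phi m).
Proof.
elim: m => [|m IH] hm.
  by rewrite /index_iota big_nil -mxf1.
rewrite rev_index_iotaS big_cons IH; last by lia.
rewrite -mulmxE MintE // mul_bidiag; apply: eq_mxf => a b _ _ /=.
case: (ltngtP a m) => ham.
- rewrite (_ : a.+1 == m.+1 = false); last by lia.
  by case: a ham => [|a] _; rewrite mul1r ?mul0r addr0.
- rewrite (_ : a.+1 == m.+1 = false); last by lia.
  case: a ham => // a ham /=; rewrite addSn ltnS.
  by case: leqP => _; rewrite ?mul1r ?mul0r ?addr0 // addrC.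
- rewrite ham eqxx /=.
  by case: (m) => [|a']; rewrite ?mul0r addr0.
Qed.

Lemma phi_tri m a b : (a < b)%N -> phi m a b = 0.
Proof.
elim: m a => [|m IH] a h /=; first by rewrite ltn_eqF.
by rewrite (IH a h) !mulr0 addr0 (IH a.-1) ?if_same //; lia.
Qed.

Lemma phi_band m a b : (b + m < a)%N -> phi m a b = 0.
Proof.
elim: m a => [|m IH] a h /=; first by rewrite gtn_eqF //; lia.
by rewrite (IH a) ?(IH a.-1) ?mulr0 ?addr0 ?if_same //; lia.
Qed.

(** Descending m rows through m factors requires a subdiagonal step in each of them, and every such
    step has weight one. *)
Lemma phi_edge m b : (b < r)%N -> phi m (b + m) b = 1.
Proof.
elim: m => [|m IH] h /=; first by rewrite addn0 eqxx.
rewrite ifF; last by lia.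
rewrite ifF; last by lia.
rewrite ifT; last by lia.
by rewrite addnS /= IH // phi_band ?mulr0 ?addr0 //; lia.
Qed.

(** The first m factors only change rows of index less than m + r. *)
Lemma phi_id m a b : (m + r <= a)%N -> phi m a b = (a == b)%:R.
Proof.
elim: m => [|m IH] h //=.
by rewrite ifF ?ifF ?ifF ?IH //; lia.
Qed.

(** By [phi_band] and [phi_edge], rows m to m + r - 1 of the first r columns form an upper
    unitriangular block. *)
Lemma phi_upper_solve m (y : nat -> F) :
  exists w : nat -> F, forall d, (d < r)%N ->
    \sum_(b < r) phi m (m + d) b * w b = y d.
Proof.
pose U : 'M[F]_r := \matrix_(d, b) phi m (m + d) b.
have Uu : U \in unitmx.
  rewrite unitmxE -det_tr det_trig.
    rewrite unitfE; apply/prodf_neq0 => i _.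
    by rewrite !mxE addnC phi_edge // oner_neq0.
  by apply/is_trig_mxP => i j h; rewrite !mxE phi_band //; lia.
pose Y : 'cV[F]_r := \col_d y d.
pose w (b : nat) := if insub b is Some i then (invmx U *m Y) i 0 else 0.
exists w => d hd.
have := mulKVmx Uu Y => /matrixP/(_ (Ordinal hd) 0); rewrite !mxE /= => <-.
by apply: eq_bigr => b _; rewrite !mxE /w valK mxE.
Qed.

(** Back substitution in the same block, starting from the last column; c counts the columns already
    treated. *)
Lemma phi_upper_ker m (w : nat -> F) :
  (forall d, (d < r)%N -> \sum_(b < r) phi m (m + d) b * w b = 0) ->
  forall b, (b < r)%N -> w b = 0.
Proof.
move=> h; suff H c b : (r - c <= b < r)%N -> w b = 0.
  by move=> b hb; apply: (H r); lia.
elim: c b => [|c IH] b hb; first by lia.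
have [hb'|hb'] := leqP (r - c) b; first by apply: IH; lia.
have br : (b < r)%N by lia.
have := h b br; rewrite (bigD1 (Ordinal br)) //= addnC phi_edge // mul1r.
rewrite big1 ?addr0 // => i; rewrite -val_eqE /= => ne.
have [hi|hi] := ltnP i b; first by rewrite phi_band ?mul0r //; lia.
by rewrite (IH i) ?mulr0 //; have := ltn_ord i; lia.
Qed.

Lemma sum_phiS m a (w : nat -> F) (N : nat) :
  \sum_(b < N) phi m.+1 a b * w b =
    if (a < m)%N then \sum_(b < N) phi m a b * w b
    else if a == m then E m.+1 m.+1 * \sum_(b < N) phi m a b * w b
    else if (a <= m + r)%N then
      \sum_(b < N) phi m a.-1 b * w b
      + E m.+1 a.+1 / E m.+1 a * \sum_(b < N) phi m a b * w b
    else \sum_(b < N) phi m a b * w b.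
Proof.
rewrite /=; case: ifP => // _; case: ifP => _.
  by rewrite mulr_sumr; apply: eq_bigr => b _; rewrite mulrA.
case: ifP => // _; rewrite mulr_sumr -big_split /=.
by apply: eq_bigr => b _; rewrite mulrDl mulrA.
Qed.

Variable k : nat.
Hypothesis E_neq0 : forall m l, (1 <= m <= k)%N -> (m <= l <= m + r)%N -> E m l != 0.

Lemma phi_diag_neq0 m a : (m <= k)%N -> phi m a a != 0.
Proof.
elim: m => [|m IH] h /=; first by rewrite eqxx oner_neq0.
have hIH := IH (ltnW h); case: (ltngtP a m) => ham //; last first.
  by rewrite mulf_neq0 // E_neq0 //; lia.
case: leqP => // hr; rewrite phi_tri ?add0r; last by lia.
by rewrite !mulf_neq0 ?invr_eq0 // E_neq0 //; lia.
Qed.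

(** As long as s <= m, the new factor changes the window of rows s to s + r - 1 by an invertible
    lower bidiagonal matrix: row a - 1 is only added when a > m, and then it lies in the window too.
    For s = m + 1 the window is the unitriangular block. *)
Lemma phi_interval_ker m s (w : nat -> F) : (m <= k)%N -> (s <= m)%N ->
  (forall a, (s <= a < s + r)%N -> \sum_(b < r) phi m a b * w b = 0) ->
  forall b, (b < r)%N -> w b = 0.
Proof.
elim: m => [|m IH] hm hs h.
  apply: (@phi_upper_ker 0) => d hd; apply: h; lia.
have [hsm|hsm] := leqP s m; last first.
  have sE : s = m.+1 by lia.
  rewrite {}sE in h.
  by apply: (@phi_upper_ker m.+1) => d hd; apply: h; lia.
apply: IH => //; first by lia.
suff H c a : (a < s + c)%N -> (s <= a < s + r)%N -> \sum_(b < r) phi m a b * w b = 0.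
  by move=> a ha; apply: (H r); lia.
elim: c a => [|c IHc] a hc ha; first by lia.
have := h a ha; rewrite sum_phiS.
case: (ltngtP a m) => ham //.
  case: leqP => // hr; rewrite (IHc a.-1) ?add0r; try lia.
  move/eqP; rewrite !mulf_eq0 invr_eq0 !(negPf (E_neq0 _ _)) /=; try lia.
  by move/eqP.
by move/eqP; rewrite mulf_eq0 (negPf (E_neq0 _ _)) /=; [move/eqP|lia|lia].
Qed.

(** For m = k these rows form a cyclic interval that wraps around. The first c rows are lower
    triangular with nonzero diagonal and kill the first c coefficients; the other rows are
    unitriangular in the remaining ones. *)
Lemma phi_wrap_ker m c (w : nat -> F) : (m <= k)%N -> (c <= r)%N ->
  (forall a, (a < c)%N || (m + c <= a < m + r)%N ->
     \sum_(b < r) phi m a b * w b = 0) ->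
  forall b, (b < r)%N -> w b = 0.
Proof.
move=> hm hc h.
have low b : (b < c)%N -> w b = 0.
  elim/ltn_ind: b => b IH hb; have br : (b < r)%N by lia.
  have := h b; rewrite hb => /(_ isT).
  rewrite (bigD1 (Ordinal br)) //= big1 ?addr0 => [|i].
    by move/eqP; rewrite mulf_eq0 (negPf (phi_diag_neq0 b hm)) => /eqP.
  rewrite -val_eqE /= neq_ltn => /orP[hi|hi]; last by rewrite phi_tri ?mul0r.
  by rewrite IH ?mulr0 //; lia.
suff high e b : (r - e <= b < r)%N -> w b = 0.
  by move=> b hb; apply: (high r); lia.
elim: e b => [|e IH] b hb; first by lia.
have [/low //|cb] := ltnP b c.
have br : (b < r)%N by lia.
have : \sum_(i < r) phi m (b + m) i * w i = 0 by apply: h; lia.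
rewrite (bigD1 (Ordinal br)) //= phi_edge // mul1r big1 ?addr0 // => i.
rewrite -val_eqE /= neq_ltn => /orP[hi|hi].
  by rewrite phi_band ?mul0r //; lia.
by rewrite IH ?mulr0 //; have := ltn_ord i; lia.
Qed.

(* Up to the factor t, the vector of the column span that gives column s + r   *)
(* of g.                                                                       *)
Lemma phi_twist (t : F) : (forall m, (1 <= m <= k)%N -> E m (m + r) = t) ->
  forall m s, (m <= k)%N -> (s < m)%N -> exists w : nat -> F,
  (forall a, (s < a)%N -> \sum_(b < r) phi m a b * w b = phi m a (s + r)) /\
  \sum_(b < r) phi m s b * w b = (-1) ^+ r.-1 * t.
Proof.
move=> Et; elim=> [|m IH] s hm hs //.
(* For an old s the same w works: the new factor fixes row s and forms each row beyond s from rows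
   beyond s. *)
have [hsm|hsm] := ltnP s m.
  have [w [h1 h2]] := IH s (ltnW hm) hsm; exists w; split; last first.
    by rewrite sum_phiS hsm.
  move=> a ha; rewrite sum_phiS /=.
  have h1' : (m < a)%N -> \sum_(b < r) phi m a.-1 b * w b = phi m a.-1 (s + r).
    by move=> ham; apply: h1; lia.
  case: (ltngtP a m) => ham; rewrite (h1 a ha) //.
  by rewrite h1'.
have -> : s = m by lia.
(* For s = m, rows m to m + r - 1 at stage m are prescribed so that the new factor makes consecutive
   terms cancel in rows m + 1 to m + r - 1. Row m becomes (-1)^(r-1) t, and row m + r becomes the
   diagonal entry t / E_(m+1,m+r). *)
pose y d := (-1) ^+ (r.-1 - d) * (t / E m.+1 (m + d).+1).
have [w hw] := phi_upper_solve m y.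
exists w; set T := fun a => \sum_(b < r) phi m a b * w b.
have T0 a : (m + r <= a)%N -> T a = 0.
  move=> ha; rewrite /T big1 // => b _; rewrite phi_id // gtn_eqF ?mul0r //.
  by apply: leq_trans (ltn_ord b) _; lia.
have TE a : (m <= a < m + r)%N ->
    T a = (-1) ^+ (r.-1 - (a - m)) * (t / E m.+1 a.+1).
  move=> ha; have := hw (a - m)%N; rewrite /y subnKC; last by lia.
  by apply; lia.
have En0 l : (m.+1 <= l <= m.+1 + r)%N -> E m.+1 l != 0 by apply: E_neq0; lia.
split; last first.
  rewrite sum_phiS ltnn eqxx -/(T m) TE; last by lia.
  rewrite subnn subn0 mulrCA; congr (_ * _).
  by rewrite mulrC divfK // En0; lia.
move=> a ha; rewrite sum_phiS -/(T a) -/(T a.-1) /=.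
have -> : (a < m)%N = false by lia.
have -> : a == m = false by lia.
have [har|har] := leqP a (m + r); last first.
  by rewrite T0 ?phi_id ?gtn_eqF //; lia.
rewrite [phi m a.-1 _]phi_tri ?add0r; last by lia.
rewrite TE; last by lia.
rewrite prednK; last by lia.
have Ea := En0 a; have [hlt|heq] := ltnP a (m + r).
  rewrite (phi_tri m hlt) mulr0 TE; last by lia.
  have -> : (r.-1 - (a.-1 - m) = (r.-1 - (a - m)).+1)%N by lia.
  rewrite exprS mulN1r mulNr [E _ _ / _ * _]mulrCA addrC.
  apply/eqP; rewrite subr_eq0; apply/eqP; congr (_ * _).
  by rewrite mulf_div [_ * t]mulrC -mulf_div divff ?mulr1 // En0; lia.
have -> : a = (m + r)%N by lia.
rewrite T0 ?mulr0 ?addr0 // phi_id // eqxx mulr1.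
have -> : E m.+1 (m + r).+1 = t by rewrite -addSn Et //; lia.
by rewrite (_ : (r.-1 - ((m + r).-1 - m) = 0)%N) ?mul1r //; lia.
Qed.

End Stages.

(** The last factor is peeled off row by row, from the top. Each row yields both the next parameter
    of that factor and the corresponding row of the previous stage, to which induction on m
    applies. *)
Lemma phi_inj (F : fieldType) r k (E E' : nat -> nat -> F) N : (0 < r)%N ->
  (forall m l, (1 <= m <= k)%N -> (m <= l <= m + r)%N -> E m l != 0) ->
  (k + r <= N)%N ->
  forall m, (m <= k)%N ->
  (forall a b, (a < N)%N -> (b < N)%N -> phi r E m a b = phi r E' m a b) ->
  forall i l, (1 <= i <= m)%N -> (i <= l < i + r)%N -> E i l = E' i l.
Proof.
move=> r0 En0 hN; elim=> [|m IH] hm heq i l hi hl; first by lia.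
suff H a : (a < N)%N ->
    (forall b, (b < N)%N -> phi r E m a b = phi r E' m a b)
    /\ ((m <= a < m + r)%N -> E m.+1 a.+1 = E' m.+1 a.+1).
  have [him|him] := leqP i m.
    by apply: IH => [|a b ha||]; [lia|exact: (H a ha).1|lia|lia].
  have -> : i = m.+1 by lia.
  have -> : l = l.-1.+1 by lia.
  by apply: (H _ _).2; lia.
have En l' : (m.+1 <= l' <= m.+1 + r)%N -> E m.+1 l' != 0 by apply: En0; lia.
elim/ltn_ind: a => a IHa ha; have := heq a _ ha => /=.
case: (ltngtP a m) => ham hrow.
- by split=> [//|]; lia.
- have [har|har] := ltnP a (m + r); last first.
    by split=> [b hb|]; [rewrite !phi_id|lia].
  have ha1 : (a.-1 < a)%N by lia.
  have [row1] := IHa a.-1 ha1 (ltn_trans ha1 ha).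
  rewrite prednK; last by lia.
  move=> /(_ ltac:(lia)) Ea.
  have cE b : (b < N)%N -> E m.+1 a.+1 / E m.+1 a * phi r E m a b
                           = E' m.+1 a.+1 / E' m.+1 a * phi r E' m a b.
    move=> hb; have := hrow b hb; rewrite (ltnW har) row1 //.
    by move/addrI.
  (* Column a - m meets row a on the bottom edge of the band, where the entry is 1 for any
     parameters; this isolates the ratio of parameters. *)
  have ed (E0 : nat -> nat -> F) : phi r E0 m a (a - m) = 1.
    by rewrite -{1}(subnK (ltnW ham)) phi_edge //; lia.
  have Eq : E m.+1 a.+1 = E' m.+1 a.+1.
    have := cE (a - m)%N; rewrite !ed !mulr1 -Ea => /(_ ltac:(lia)).
    by apply/mulIf; rewrite invr_eq0 En //; lia.
  split=> // b hb; have := cE b hb; rewrite -Eq -Ea; apply/mulfI.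
  by rewrite mulf_neq0 ?invr_eq0 ?En //; lia.
- have ed (E0 : nat -> nat -> F) : phi r E0 m m 0 = 1.
    by have := phi_edge E0 r0 m r0.
  have N0 : (0 < N)%N by lia.
  have Eq : E m.+1 m.+1 = E' m.+1 m.+1.
    by have := hrow 0%N N0; rewrite ham !ed !mulr1.
  split=> [b hb|_]; last by rewrite ham.
  by have := hrow b hb; rewrite -Eq; apply/mulfI; rewrite En //; lia.
Qed.

(** * Ratios of Pluecker coordinates *)

Section PluckerRatios.

Variables (F : fieldType) (n : nat) (M : {vspace 'cV[F]_n}) (r : nat).
Hypothesis dimM : \dim M = r.

(** Passing through functions on naturals avoids a cast between ['I_(\dim M)] and ['I_r]. *)
Let sum_dim (f : nat -> 'cV[F]_n) : \sum_(i < \dim M) f i = \sum_(i < r) f i.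
Proof. by rewrite dimM. Qed.

Lemma frame_mulE (w : 'cV[F]_r) :
  frame r M *m w = \sum_(j < r) w j 0 *: (vbasis M)`_j.
Proof.
apply/matrixP => i j; rewrite ord1 !mxE summxE; apply: eq_bigr => l _.
by rewrite !mxE mulrC.
Qed.

Lemma frame_mul_in (w : 'cV[F]_r) : frame r M *m w \in M.
Proof.
rewrite frame_mulE; apply: memv_suml => j _; apply/memvZ/vbasis_mem/mem_nth.
by rewrite size_tuple dimM.
Qed.

Lemma frame_surj v : v \in M -> exists w : 'cV[F]_r, v = frame r M *m w.
Proof.
move=> vM; pose c (j : nat) : F :=
  if insub j is Some i then coord (vbasis M) i v else 0.
exists (\col_j c j); rewrite frame_mulE {1}(coord_vbasis vM).
rewrite (eq_bigr (fun i : 'I_(\dim M) => c i *: (vbasis M)`_i)); last first.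
  by move=> i _; rewrite /c valK.
rewrite (sum_dim (fun i => c i *: (vbasis M)`_i)).
by apply: eq_bigr => i _; rewrite mxE.
Qed.

Lemma frame_inj (w : 'cV[F]_r) : frame r M *m w = 0 -> w = 0.
Proof.
rewrite frame_mulE => h.
pose c (j : nat) : F := if insub j is Some i then w i 0 else 0.
have cw (i : 'I_r) : c i = w i 0 by rewrite /c valK.
have := vbasisP M => /andP[_ /freeP/(_ (fun i => c i))].
rewrite (sum_dim (fun i => c i *: (vbasis M)`_i)).
rewrite (eq_bigr (fun j : 'I_r => w j 0 *: (vbasis M)`_j)); last first.
  by move=> i _; rewrite cw.
move=> /(_ h) h0; apply/matrixP => i j; rewrite ord1 mxE -cw.
have hi : (i < \dim M)%N by rewrite dimM.
exact: (h0 (Ordinal hi)).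
Qed.

Definition subdet (J : {set 'I_n}) : F :=
  \det (\matrix_(a < r, b < r) [seq frame r M i b | i <- enum J]`_a).

Lemma pluckerE I : #|residues n I| = r -> plucker r M I = subdet (residues n I).
Proof. by move=> h; rewrite /plucker h eqxx. Qed.

Lemma plucker_eq0 I : #|residues n I| != r -> plucker r M I = 0.
Proof. by move=> /negPf h; rewrite /plucker h. Qed.

(** A kernel vector of the square submatrix is the coordinate vector of an element of M vanishing on
    J. This reduces Pluecker coordinates to the kernel lemmas for [phi]. *)
Lemma subdet_neq0P (J : {set 'I_n}) : #|J| = r ->
  (subdet J != 0) <-> (forall v, v \in M -> (forall x, x \in J -> v x 0 = 0) -> v = 0).
Proof.
move=> cJ; set Q := \matrix_(a, b) [seq frame r M i b | i <- enum J]`_a : 'M[F]_r.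
have QE (x0 : 'I_n) a (w : 'cV[F]_r) :
    (Q *m w) a 0 = (frame r M *m w) (nth x0 (enum J) a) 0 :> F.
  rewrite !mxE; apply: eq_bigr => b _; rewrite !mxE (nth_map x0) ?mxE //.
  by rewrite -cardE cJ.
split=> [dn0 v vM v0|h].
  have [w E] := frame_surj vM.
  have Qu : Q \in unitmx by rewrite unitmxE unitfE.
  have Q0 : Q *m w = 0.
    apply/matrixP => a b; rewrite ord1 [RHS]mxE.
    have [x0 xJ] : exists x0, x0 \in J.
      by apply/card_gt0P; rewrite cJ; apply: leq_ltn_trans (ltn_ord a).
    rewrite (QE x0) -E v0 // -mem_enum mem_nth // -cardE cJ //.
  by rewrite E -(mulKmx Qu w) Q0 !mulmx0.
rewrite /subdet -/Q -det_tr; apply/negP => /det0P[u un0 uQ].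
have Qu0 : Q *m u^T = 0 by rewrite -[LHS]trmxK trmx_mul trmxK uQ trmx0.
case/negP: un0; rewrite -[u]trmxK (@frame_inj u^T) ?trmx0 //.
apply: h => [|x xJ]; first exact: frame_mul_in.
have hx : (index x (enum J) < r)%N by rewrite -cJ cardE index_mem mem_enum.
have := QE x (Ordinal hx) u^T.
by rewrite Qu0 /= nth_index ?mem_enum // mxE.
Qed.

(** Enumerations of sets are increasing, so p is inserted just after the smaller elements. Its
    position governs the sign of the minor. *)
Lemma enum_setU1 (J : {set 'I_n}) p : p \notin J ->
  exists s1 s2, [/\ enum J = s1 ++ s2, enum (p |: J) = s1 ++ p :: s2
                  & size s1 = #|[set x in J | (x < p)%N]|].
Proof.
move=> pJ.
have srt : pairwise (relpre val ltn) (enum 'I_n).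
  rewrite -pairwise_map val_enum_ord -sorted_pairwise ?iota_ltn_sorted //.
  exact: ltn_trans.
have eqf (A : {set 'I_n}) : enum A = filter (mem A) (enum 'I_n).
  by rewrite {1}/enum_mem enumT.
have pin : p \in enum 'I_n by rewrite mem_enum.
have [l1 [l2 El]] : exists l1 l2, enum 'I_n = l1 ++ p :: l2.
  by case/splitPr: pin => l1 l2; exists l1, l2.
move: srt; rewrite El pairwise_cat /= => /and3P[rel _ /andP[h2 _]].
have h1 : all (fun x : 'I_n => x < p)%N l1.
  by apply/allP => x hx; apply: (allrelP rel) => //; rewrite mem_head.
have f1 x : x \in l1 -> (x \in p |: J) = (x \in J).
  move=> /(allP h1) lt; rewrite in_setU1; case: eqP lt => // ->.
  by rewrite ltnn.
have f2 x : x \in l2 -> (x \in p |: J) = (x \in J).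
  move=> /(allP h2) /= lt; rewrite in_setU1; case: eqP lt => // ->.
  by rewrite ltnn.
exists (filter (mem J) l1), (filter (mem J) l2); split.
- by rewrite eqf El filter_cat /= (negPf pJ).
- rewrite eqf El filter_cat /= in_setU1 eqxx /=; congr (_ ++ _ :: _).
    exact: eq_in_filter.
  exact: eq_in_filter.
rewrite cardE eqf El filter_cat size_cat /= inE ltnn andbF.
rewrite [X in (_ + size X)%N](_ : _ = [::]) ?addn0.
  congr size; apply: eq_in_filter => x /(allP h1) lt.
  by rewrite /= inE lt andbT.
apply/eqP; rewrite -[_ == _]negbK -has_filter; apply/hasPn => x /(allP h2) /= lt.
by rewrite inE [(x < p)%N]ltnNge (ltnW lt) andbF.
Qed.

Definition pos (J : {set 'I_n}) (p : 'I_n) : nat := #|[set x in J | (x < p)%N]|.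

(* Linear in the row p, hence p |-> rowdet J p is a vector of M.               *)
Let rowdet (J : {set 'I_n}) (p : 'I_n) : F :=
  \det (\matrix_(a < r, b < r)
    (if (a : nat) is a'.+1 then [seq frame r M i b | i <- enum J]`_a'
     else frame r M p b)).

Hypothesis r_gt0 : (0 < r)%N.

(** These are the minors in the expansion of [rowdet] along its first row. *)
Let mi (J : {set 'I_n}) (j : 'I_r) : F :=
  \det (\matrix_(a < r.-1, b < r.-1) [seq frame r M i (lift j b) | i <- enum J]`_a).

Let rowdetE (J : {set 'I_n}) p : #|J| = r.-1 ->
  rowdet J p = \sum_(j < r) frame r M p j * ((-1) ^+ j * mi J j).
Proof.
move=> cJ; rewrite /rowdet (expand_det_row _ (Ordinal r_gt0)).
apply: eq_bigr => j _; rewrite mxE /=; congr (_ * _).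
rewrite /cofactor /= add0n; congr (_ * \det _).
by apply/matrixP => a b; rewrite !mxE.
Qed.

(** Both determinants are expanded along the row of p, which stands first in one and at its sorted
    place in the other. *)
Let subdet_rowdet (J : {set 'I_n}) p : #|J| = r.-1 -> p \notin J ->
  subdet (p |: J) = (-1) ^+ pos J p * rowdet J p.
Proof.
move=> cJ pJ; have [s1 [s2 [E1 E2 E3]]] := enum_setU1 pJ.
have szr : (size s1 + size s2 = r.-1)%N by rewrite -size_cat -E1 -cardE.
have hi : (size s1 < r)%N by lia.
rewrite rowdetE // mulr_sumr /subdet (expand_det_row _ (Ordinal hi)).
apply: eq_bigr => j _.
have Hnth (f : 'I_n -> F) (a : nat) : (a < r)%N ->
    [seq f i | i <- enum (p |: J)]`_a = f (nth p (s1 ++ p :: s2) a).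
  by move=> ha; rewrite E2 (nth_map p) // size_cat /= addnS szr prednK.
rewrite mxE Hnth // nth_cat ltnn subnn /= [RHS]mulrCA; congr (_ * _).
rewrite /cofactor /= exprD -mulrA /pos -E3; congr (_ * (_ * \det _)).
apply/matrixP => a b; rewrite !mxE Hnth //.
rewrite (nth_map p) -?cardE ?cJ // E1 !nth_cat /=; congr (frame r M _ _).
rewrite /bump; case: (leqP (size s1) a) => ha.
  by rewrite add1n ltnNge ltnW //= subSn.
by rewrite add0n ha.
Qed.

(** Since the minor on q |: J is nonzero, a vector of M vanishing on J is unique up to scalars. Both
    v and the vector of the [rowdet J x] are such, hence proportional. *)
Lemma subdet_ratio (J : {set 'I_n}) p q v : #|J| = r.-1 -> p \notin J -> q \notin J ->
  subdet (q |: J) != 0 -> v \in M -> (forall x, x \in J -> v x 0 = 0) ->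
  v q 0 != 0 ->
  subdet (p |: J) / subdet (q |: J) =
  (-1) ^+ pos J p * (-1) ^+ pos J q * (v p 0 / v q 0).
Proof.
move=> cJ pJ qJ sq vM v0 vq.
have cU : #|q |: J| = r by rewrite cardsU1 qJ cJ add1n prednK.
pose u : 'cV[F]_r := \col_j ((-1) ^+ j * mi J j).
have rdE x : rowdet J x = (frame r M *m u) x 0.
  by rewrite rowdetE // mxE; apply: eq_bigr => j _; rewrite [u _ _]mxE.
have rd0 x : x \in J -> rowdet J x = 0.
  move=> xJ.
  have hx : ((index x (enum J)).+1 < r)%N.
    by rewrite -(prednK r_gt0) ltnS -cJ cardE index_mem mem_enum.
  apply: (@determinant_alternate _ _ _ (Ordinal r_gt0) (Ordinal hx)) => // b.
  by rewrite mxE [RHS]mxE /= (nth_map x) ?index_mem ?mem_enum // nth_index ?mem_enum.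
have ent x : (rowdet J q *: v - v q 0 *: (frame r M *m u)) x 0
    = rowdet J q * v x 0 - v q 0 * rowdet J x.
  by rewrite (rdE x); move: (frame r M *m u) => V; rewrite !mxE.
have key : rowdet J q *: v - v q 0 *: (frame r M *m u) = 0.
  apply: ((subdet_neq0P cU).1 sq) => [|x].
    by rewrite memvB ?memvZ // frame_mul_in.
  rewrite ent; case/setU1P => [->|xJ]; first by rewrite mulrC subrr.
  by rewrite (v0 x) // (rd0 x) // !mulr0 subrr.
have := congr1 (fun A : 'cV[F]_n => A p 0) key; rewrite ent [in RHS]mxE.
move/eqP; rewrite subr_eq0 => /eqP Epq.
have rq : rowdet J q != 0.
  by move: sq; rewrite subdet_rowdet // mulf_eq0 negb_or => /andP[].
rewrite !subdet_rowdet // invfM invr_sign -!mulrA; congr (_ * _).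
rewrite mulrCA; congr (_ * _).
by apply/eqP; rewrite eqr_div // mulrC -Epq mulrC.
Qed.

End PluckerRatios.

(** * Cyclic intervals modulo n *)

Section Residues.

Lemma mem_intervalz (a b i : int) : (i \in intervalz a b) = (a <= i <= b).
Proof.
rewrite /intervalz; case: ifP => hab; last by rewrite in_nil; lia.
apply/mapP/idP => [[d]|h]; first by rewrite mem_iota => hd ->; lia.
by exists `|i - a|%N; rewrite ?mem_iota; lia.
Qed.

Lemma mem_residues n (I : seq int) (x : 'I_n) :
  (x \in residues n I) = has (fun i => (i == x.+1%:Z %[mod n])%Z) I.
Proof. by rewrite inE. Qed.

Lemma mem_residues_interval n j d (x : 'I_n) : (1 <= j <= n)%N -> (d < n)%N ->
  (x \in residues n (intervalz (j%:Z - d%:Z) (j%:Z - 1))) =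
  if (d < j)%N then (j - d <= x.+1 < j)%N
  else ((x.+1 < j) || (n + j - d <= x.+1))%N.
Proof.
move=> hj hd; have hx := ltn_ord x; rewrite mem_residues; apply/hasP/idP.
  case=> i; rewrite mem_intervalz => hi; rewrite eqz_mod_dvd => /dvdzP[q Eq].
  (* As d < n, the interval wraps around at most once. *)
  have : q = 0 \/ q = -1 by nia.
  by case: ifP => hdj; case=> Eq0; rewrite Eq0 in Eq; lia.
have in1 (i : int) : j%:Z - d%:Z <= i <= j%:Z - 1 -> (i == x.+1%:Z %[mod n])%Z ->
    exists2 i0, i0 \in intervalz (j%:Z - d%:Z) (j%:Z - 1)
      & (i0 == x.+1%:Z %[mod n])%Z.
  by move=> h1 h2; exists i; rewrite ?mem_intervalz.
case: ifP => hdj h.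
  by apply: (in1 x.+1%:Z); [lia|].
case/orP: h => h; first by apply: (in1 x.+1%:Z); [lia|].
apply: (in1 (x.+1%:Z - n%:Z)); first by lia.
by rewrite eqz_mod_dvd; apply/dvdzP; exists (-1); lia.
Qed.

Lemma residues_rcons n I (p : 'I_n) :
  residues n (rcons I p.+1%:Z) = p |: residues n I.
Proof.
apply/setP => x; rewrite in_setU1 !mem_residues has_rcons; congr (_ || _).
have hx := ltn_ord x; have hp := ltn_ord p.
rewrite eqz_mod_dvd; apply/dvdzP/eqP => [[q Eq]|->]; last by exists 0; lia.
apply: val_inj => /=; have : q = 0 by nia.
by move=> q0; rewrite q0 in Eq; lia.
Qed.

End Residues.

(** * Spans of the leading columns of a matrix *)

Section ColumnSpans.

Variables (F : fieldType) (n r : nat).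

Lemma eq_span_cols (A B : 'M[F]_n) :
  (forall j : 'I_n, (j < r)%N -> col j A = col j B) -> span_cols r A = span_cols r B.
Proof.
move=> h; rewrite /span_cols; congr span; apply/eq_in_map => j.
by rewrite mem_filter => /andP[/h].
Qed.

Hypothesis r_le : (r <= n)%N.

Lemma span_cols_limg g : span_cols r (mxf n g) =
  limg (linfun (mulmx (\matrix_(a < n, b < r) g a b) : 'cV[F]_r -> 'cV[F]_n)).
Proof.
set B := \matrix_(a, b) _; apply/eqP; rewrite eqEsubv; apply/andP; split.
  apply/span_subvP => u /mapP[j]; rewrite mem_filter => /andP[hj _] ->.
  apply/memv_imgP; exists (delta_mx (Ordinal hj) 0); first exact: memvf.
  rewrite lfunE /= -colE; apply/matrixP => a b; rewrite !mxE //.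
apply/subvP => u /memv_imgP[w _ ->]; rewrite lfunE /=.
have -> : B *m w = \sum_(b < r) w b 0 *: col (widen_ord r_le b) (mxf n g).
  apply/matrixP => a c; rewrite ord1 !mxE summxE; apply: eq_bigr => b _.
  by rewrite !mxE mulrC.
apply: memv_suml => b _; apply/memvZ/memv_span/map_f.
by rewrite mem_filter mem_enum andbT /=.
Qed.

Lemma span_cols_mxfP (g : nat -> nat -> F) (v : 'cV[F]_n) :
  v \in span_cols r (mxf n g) <->
  exists w : nat -> F, forall a : 'I_n, v a 0 = \sum_(b < r) g a b * w b.
Proof.
rewrite span_cols_limg; split=> [/memv_imgP[w _ ->]|[w hw]].
  exists (fun b => if insub b is Some i then w i 0 else 0) => a.
  rewrite lfunE /= mxE; apply: eq_bigr => b _; rewrite mxE valK //.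
apply/memv_imgP; exists (\col_b w b); first exact: memvf.
rewrite lfunE /=; apply/matrixP => a c; rewrite ord1 hw mxE.
by apply: eq_bigr => b _; rewrite !mxE.
Qed.

Lemma dim_span_cols (g : nat -> nat -> F) :
  (forall w : nat -> F, (forall a, (a < n)%N -> \sum_(b < r) g a b * w b = 0) ->
     forall b, (b < r)%N -> w b = 0) ->
  \dim (span_cols r (mxf n g)) = r.
Proof.
move=> h; rewrite span_cols_limg; set f := linfun _.
suff ker0 : (fullv :&: lker f = 0)%VS.
  by rewrite limg_dim_eq // dimvf /dim /= ?muln1.
apply/eqP; rewrite capfv -subv0; apply/subvP => w.
rewrite memv_ker lfunE /= => /eqP hw; rewrite memv0; apply/eqP.
apply/matrixP => b c; rewrite ord1 mxE.
have := h (fun b => if insub b is Some i then w i 0 else 0) _ b (ltn_ord b).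
rewrite valK; apply=> a ha.
have := congr1 (fun A : 'cV[F]_n => A (Ordinal ha) 0) hw; rewrite !mxE => E.
by rewrite -[RHS]E; apply: eq_bigr => i _; rewrite mxE valK.
Qed.

End ColumnSpans.

(** * The map S *)

Lemma card_ord_interval n lo hi : (lo <= hi <= n)%N ->
  #|[set x : 'I_n | (lo <= x < hi)%N]| = (hi - lo)%N.
Proof.
case/andP=> h1 h2; rewrite -sum1_card.
rewrite (eq_bigl (fun y : 'I_n => (lo <= y < hi)%N)); last by move=> y; rewrite inE.
rewrite -(big_mkord (fun i => lo <= i < hi)%N (fun=> 1%N)).
rewrite -[RHS]muln1 -sum_nat_const_nat.
rewrite (big_nat_widen _ _ _ _ _ h2) (big_nat_widenl _ _ _ _ _ (leq0n lo)).
by apply: eq_bigl => i; rewrite /= andbC.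
Qed.

(** * Coordinates on the torus *)

Section Coordinates.

Variables (n k : nat).
Hypothesis hk : (1 <= k < n)%N.

Lemma in_R_ex i j : in_R n k i j ->
  exists2 p : Rset n k, fst_R p = i & snd_R p = j.
Proof.
move=> hR; have hi : (i < n)%N by move: hR; rewrite /in_R; lia.
have hj : (j < n)%N by move: hR; rewrite /in_R; lia.
by exists (exist _ (Ordinal hi, Ordinal hj) hR).
Qed.

Lemma in_R_Rset (p : Rset n k) : in_R n k (fst_R p) (snd_R p).
Proof. by case: p. Qed.

Lemma entry_R (T : zmodType) (x : rpoint n k T) p : entry x (fst_R p) (snd_R p) = x.1 p.
Proof.
rewrite /entry; case: pickP => [q /andP[/eqP h1 /eqP h2]|/(_ p)]; last by rewrite !eqxx.
congr (x.1 _); apply: val_inj; case: q p h1 h2 => [[q1 q2] hq] [[p1 p2] hp].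
by rewrite /fst_R /snd_R /= => h1 h2; congr (_, _); apply: val_inj.
Qed.

Variable F : fieldType.

Lemma entry_neq0 (x : rpoint n k F) i j : in_torus x -> in_R n k i j ->
  entry x i j != 0.
Proof. by move=> hx /in_R_ex[p <- <-]; rewrite entry_R; apply: (hx (Some p)). Qed.

(** Each row of the array is prolonged by a final entry t, which is the parameter of the diagonal
    factor t_j. *)
Definition ext_entry (x : rpoint n k F) (i l : nat) : F :=
  if l == (i + (n - k))%N then x.2 else entry x i l.

Lemma ext_entry_neq0 x m l : in_torus x -> (1 <= m <= k)%N ->
  (m <= l <= m + (n - k))%N -> ext_entry x m l != 0.
Proof.
move=> hx hm hl; rewrite /ext_entry; have [_|ne] := eqVneq l _; first exact: (hx None).
by apply: entry_neq0 => //; rewrite /in_R; lia.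
Qed.

Lemma Phi_prod (x : rpoint n k F) : Phi x =
  \prod_(i <- rev (index_iota 1 k.+1)) Mint n i (i + (n - k)) (ext_entry x i).
Proof.
by rewrite /Phi; apply: eq_bigr => i _; rewrite /ext_entry addnBA //; lia.
Qed.

Lemma Phi_mxf (x : rpoint n k F) : Phi x = mxf n (phi (n - k) (ext_entry x) k).
Proof. by rewrite Phi_prod prod_MintE //; lia. Qed.

End Coordinates.

(** * The matrix g at a point of the image of Theta *)

Section Columns.

Variables (F : fieldType) (n k : nat).
Hypothesis hk : (1 <= k < n)%N.
Variable x : rpoint n k F.
Hypothesis hx : in_torus x.

Let r := (n - k)%N.
Let r_gt0 : (0 < r)%N. Proof. rewrite /r; lia. Qed.
Let nE : n = (k + r)%N. Proof. rewrite /r; lia. Qed.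
Let r_le : (r <= n)%N. Proof. rewrite /r; lia. Qed.
Let E := ext_entry x.
Let ph := phi r E k.
Let M := (Theta x).1.
Let t := x.2.

Let E_neq0 m l : (1 <= m <= k)%N -> (m <= l <= m + r)%N -> E m l != 0.
Proof. by move=> *; apply: ext_entry_neq0. Qed.

Let ME : M = span_cols r (mxf n ph).
Proof. by rewrite /M /Theta /= Phi_mxf. Qed.

Lemma dim_Theta : \dim (Theta x).1 = r.
Proof.
rewrite -/M ME dim_span_cols // => w h; apply: (@phi_upper_ker _ _ E r_gt0 k) => d hd.
by apply: h; rewrite nE ltn_add2l.
Qed.

Lemma Theta_grass : in_grass r (Theta x).
Proof. by rewrite /in_grass dim_Theta eqxx (hx None). Qed.

(** In column b of g, [J0 b] is the index set of the numerator without i and [J1 b] that of the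
    denominator; they differ by the one element [q b] below. *)
Let J0 (b : 'I_n) := residues n (intervalz (b.+1%:Z - r%:Z + 1) (b.+1%:Z - 1)).
Let J1 (b : 'I_n) := residues n (intervalz (b.+1%:Z - r%:Z) (b.+1%:Z - 1)).

Let mem_J0 b (y : 'I_n) : (y \in J0 b) =
  if (b < r)%N then ((y < b) || (k + b < y))%N else (b - r < y < b)%N.
Proof.
have hb := ltn_ord b; have hy := ltn_ord y.
have -> : J0 b = residues n (intervalz (b.+1%:Z - r.-1%:Z) (b.+1%:Z - 1)).
  by rewrite /J0; congr (residues n (intervalz _ _)); lia.
rewrite mem_residues_interval; [|lia|lia].
by do 2!case: ifP => ?; lia.
Qed.

Let mem_J1 b (y : 'I_n) : (y \in J1 b) =
  if (b < r)%N then ((y < b) || (k + b <= y))%N else (b - r <= y < b)%N.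
Proof.
have hb := ltn_ord b; have hy := ltn_ord y.
rewrite mem_residues_interval; [|lia|lia].
by do 2!case: ifP => ?; lia.
Qed.

Let qval (b : 'I_n) : nat := if (b < r)%N then (k + b)%N else (b - r)%N.
Let qval_lt b : (qval b < n)%N.
Proof. by have := ltn_ord b; rewrite /qval; case: ifP; lia. Qed.
Let q b : 'I_n := Ordinal (qval_lt b).

Let qJ0 b : q b \notin J0 b.
Proof. by rewrite mem_J0 /q /= /qval; case: (ltnP b r) => ?; lia. Qed.

Let J1E b : J1 b = q b |: J0 b.
Proof.
apply/setP => y; rewrite in_setU1 mem_J0 mem_J1 -val_eqE /= /qval.
by have := ltn_ord b; case: (ltnP b r) => ?; lia.
Qed.

Let card_J0 b : #|J0 b| = r.-1.
Proof.
have hb := ltn_ord b.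
have [br|br] := ltnP b r.
  have -> : J0 b = ~: [set y : 'I_n | (b <= y < (k + b).+1)%N].
    by apply/setP => y; rewrite mem_J0 br !inE; lia.
  by rewrite cardsCs setCK card_ord card_ord_interval; lia.
have -> : J0 b = [set y : 'I_n | ((b - r).+1 <= y < b)%N].
  by apply/setP => y; rewrite mem_J0 ltnNge br inE.
by rewrite card_ord_interval; lia.
Qed.

Let card_J1 b : #|J1 b| = r.
Proof. by rewrite J1E cardsU1 qJ0 card_J0; lia. Qed.

Let subdet_J1 b : subdet M r (J1 b) != 0.
Proof.
apply/(subdet_neq0P dim_Theta (card_J1 b)) => v; rewrite -/M ME.
case/(span_cols_mxfP r_le) => w hw v0.
have hb := ltn_ord b.
have row0 a (ha : (a < n)%N) : (if (b < r)%N then ((a < b) || (k + b <= a))%N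
    else (b - r <= a < b)%N) -> \sum_(i < r) ph a i * w i = 0.
  by move=> h; rewrite -(hw (Ordinal ha)) v0 // mem_J1.
have w0 i : (i < r)%N -> w i = 0.
  have [br|br] := ltnP b r.
    apply: (@phi_wrap_ker _ _ E r_gt0 k E_neq0 k b) => //; first exact: ltnW.
    by move=> a ha; apply: row0; rewrite ?br; lia.
  apply: (@phi_interval_ker _ _ E r_gt0 k E_neq0 k (b - r)) => //; first lia.
  by move=> a ha; apply: row0; rewrite ?(ltnNge b) ?br /=; lia.
apply/matrixP => a c; rewrite ord1 hw mxE big1 // => i _.
by rewrite w0 ?mulr0.
Qed.

Lemma plucker_interval_neq0 j : (1 <= j <= n)%N ->
  plucker r (Theta x).1 (intervalz (j%:Z - r%:Z) (j%:Z - 1)) != 0.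
Proof.
case: j => // j /= hj; have := subdet_J1 (Ordinal hj).
by rewrite /plucker -/(J1 (Ordinal hj)) card_J1 eqxx.
Qed.

(* The lambda-entries of g vanish in the last n - k rows, which are all that   *)
(* S uses.                                                                     *)
Lemma gmat_Theta (a b : 'I_n) (lam : F) : (k <= a)%N \/ lam = 0 ->
  (gmat r (Theta x).1 x.2 a b).[lam] = Phi x a b.
Proof.
move=> hlam; have ha := ltn_ord a; have hb := ltn_ord b.
rewrite Phi_mxf // !mxE -/r -/E -/ph /=.
rewrite hornerM hornerC (pluckerE M (card_J1 b)) -/(J1 b).
set c := horner _ lam.
(* For a in [J0 b] the numerator has a repeated index, and the position (a, b) lies above the
   diagonal or below the band of Phi. *)
have [aJ|aJ] := boolP (a \in J0 b).
  rewrite plucker_eq0 ?mul0r ?mulr0; last first.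
    have aU : a |: J0 b = J0 b by apply/setUidPr; rewrite sub1set.
    by rewrite residues_rcons -/(J0 b) aU card_J0 neq_ltn prednK // leqnn.
  move: aJ; rewrite mem_J0; case: ifP => br.
    by case/orP => h; rewrite /ph; [rewrite phi_tri|rewrite phi_band //; lia].
  by move=> h; rewrite /ph phi_tri //; lia.
rewrite pluckerE residues_rcons -/(J0 b); last first.
  by rewrite cardsU1 aJ card_J0; lia.
have ratio v := @subdet_ratio _ _ M r dim_Theta r_gt0 (J0 b) a (q b) v
  (card_J0 b) aJ (qJ0 b).
(* For b < r, column b of Phi itself is the vector of M vanishing on [J0 b]. It equals 1 at [q b],
   and the two position signs agree. *)
have [br|br] := ltnP b r.
  have vM : col b (mxf n ph) \in M.
    rewrite ME; apply/memv_span/map_f.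
    by rewrite mem_filter br mem_enum.
  have vq : (col b (mxf n ph)) (q b) 0 = 1.
    by rewrite !mxE /= /qval br addnC /ph phi_edge.
  rewrite J1E (ratio (col b (mxf n ph))) -?J1E //; last 2 first.
  - move=> y; rewrite mem_J0 br !mxE; case/orP => h.
      by rewrite /ph phi_tri.
    by rewrite /ph phi_band // addnC.
  - by rewrite vq oner_neq0.
  have posE p : p \notin J0 b -> pos (J0 b) p = b.
    rewrite mem_J0 br => hp; rewrite /pos.
    have -> : [set y in J0 b | (y < p)%N] = [set y : 'I_n | (0 <= y < b)%N].
      by apply/setP => y; rewrite [LHS]in_set mem_J0 br [RHS]in_set; lia.
    by rewrite card_ord_interval; lia.
  rewrite !posE // vq divr1 !mxE /c br hornerC mul1r -exprD addnn.
  by rewrite -signr_odd odd_double mul1r.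
have brF : (b < r)%N = false by rewrite ltnNge br.
(* Above the diagonal with b >= r, a row a >= k would belong to [J0 b]; this leaves lambda = 0. *)
have [ab|ab] := ltnP a b.
  case: hlam => [ka|lam0].
    by move: aJ; rewrite mem_J0 ltnNge br /=; lia.
  rewrite /c brF ifF ?hornerX ?lam0 ?mul0r; last by lia.
  by rewrite /ph phi_tri.
have posa : pos (J0 b) a = r.-1.
  rewrite -(card_J0 b) /pos; congr #|pred_of_set _|; apply/setP => y.
  by rewrite in_set mem_J0 ltnNge br /=; lia.
have posq : pos (J0 b) (q b) = 0%N.
  apply/eqP; rewrite cards_eq0; apply/eqP/setP => y.
  by rewrite [RHS]in_set0 in_set mem_J0 /= /qval ltnNge br /=; lia.
have Et m : (1 <= m <= k)%N -> E m (m + r) = t by rewrite /E /ext_entry eqxx.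
have hs : (b - r < k)%N by lia.
(* The value (-1)^(r-1) t of this vector at [q b] absorbs both the position sign and the factor c_ij
   = t of g. *)
have [w [w1 w2]] := phi_twist r_gt0 E_neq0 Et (leqnn k) hs.
pose v : 'cV[F]_n := \col_y \sum_(i < r) ph y i * w i.
have vM : v \in M.
  by rewrite ME; apply/(span_cols_mxfP r_le); exists w => y; rewrite mxE.
have vE (y : 'I_n) : (b - r < y)%N -> v y 0 = ph y b.
  by move=> hy; rewrite mxE w1 // subnK.
have t0 : t != 0 by exact: (hx None).
have vq : v (q b) 0 = (-1) ^+ r.-1 * t.
  by rewrite mxE /= /qval ltnNge br.
rewrite J1E (ratio v) -?J1E //; last 2 first.
- move=> y; rewrite mem_J0 ltnNge br /= => hy.
  by rewrite vE ?/ph ?phi_tri //; lia.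
- by rewrite vq mulf_neq0 // signr_eq0.
rewrite posa posq mulr1 vq vE; last by lia.
rewrite invfM invr_sign [ph a b * _]mulrCA signrMK.
by rewrite /c brF ifT // hornerC -/t mulrC divfK.
Qed.

End Columns.

(** Evaluating g at lambda = 0 recovers the matrix Phi from the subspace and t, and [phi_inj] then
    recovers the parameters. *)
Lemma Theta_inj (F : fieldType) (n k : nat) (x y : rpoint n k F) :
  (1 <= k < n)%N -> in_torus x -> in_torus y -> Theta x = Theta y -> x = y.
Proof.
move=> hk hx hy eqT.
have eqt : x.2 = y.2 by have := congr1 snd eqT.
have eqPhi : Phi x = Phi y.
  apply/matrixP => a b.
  have PhiE (z : rpoint n k F) : in_torus z ->
      Phi z a b = (gmat (n - k) (Theta z).1 z.2 a b).[0].
    by move=> hz; rewrite gmat_Theta //; right.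
  by rewrite (PhiE x hx) (PhiE y hy) eqT eqt.
have r0 : (0 < n - k)%N by lia.
have eqE : forall i l, (1 <= i <= k)%N -> (i <= l < i + (n - k))%N ->
    ext_entry x i l = ext_entry y i l.
  apply: (@phi_inj F (n - k) k _ _ n r0); [|lia|exact: leqnn|].
    by move=> m l; apply: ext_entry_neq0.
  move=> a b ha hb; move/matrixP/(_ (Ordinal ha) (Ordinal hb)): eqPhi.
  by rewrite !Phi_mxf // !mxE.
case: x y eqE eqt {hx hy eqT eqPhi} => [x t] [y t'] eqE /= ->; congr (_, _).
apply/ffunP => p; have := in_R_Rset p; rewrite /in_R => hp.
have ne : (snd_R p == fst_R p + (n - k))%N = false by lia.
have := eqE (fst_R p) (snd_R p); rewrite /ext_entry ne.
by rewrite !entry_R /=; apply; lia.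
Qed.

(** * Flipping the bidiagonal factors *)

Section Flip.

Variables (F : fieldType) (n : nat).

Lemma fl_mul (A B : 'M[F]_n) : fl (A * B) = fl B * fl A.
Proof.
apply/matrixP => a b; rewrite -!mulmxE !mxE (reindex_inj rev_ord_inj) /=.
by apply: eq_bigr => j _; rewrite !mxE mulrC.
Qed.

Lemma fl1 : fl (1 : 'M[F]_n) = 1.
Proof.
by apply/matrixP => a b; rewrite !mxE (inj_eq rev_ord_inj) eq_sym.
Qed.

Lemma fl_prod (T : Type) (s : seq T) (A : T -> 'M[F]_n) :
  fl (\prod_(i <- s) A i) = \prod_(i <- rev s) fl (A i).
Proof.
elim: s => [|i s IH]; first by rewrite !big_nil fl1.
by rewrite big_cons fl_mul IH rev_cons -cats1 big_cat big_seq1.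
Qed.

Lemma fl_mxf (g : nat -> nat -> F) :
  fl (mxf n g) = mxf n (fun a b => g (n - b.+1) (n - a.+1))%N.
Proof. by apply/matrixP => a b; rewrite !mxE. Qed.

(** The flip reverses the diagonal c_i, c_(i+1)/c_i, ..., t/c_(i+r-1). Under c' = t/c in reversed
    order, inner quotients become inner quotients and the two end entries are exchanged. *)
Lemma fl_Mint i j r (c c' : nat -> F) t :
  (0 < r)%N -> (0 < i)%N -> (0 < j)%N -> (i + j + r = n.+1)%N -> t != 0 ->
  c (i + r)%N = t -> c' (j + r)%N = t ->
  (forall l, (i <= l < i + r)%N -> c l != 0) ->
  (forall l, (j <= l < j + r)%N -> c' l = t / c (n - l)%N) ->
  fl (Mint n i (i + r) c) = Mint n j (j + r) c'.
Proof.
move=> r0 i0 j0 hij t0 ct ct' cn0 c'E.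
rewrite !MintE; [|lia|lia|lia|lia]; rewrite fl_mxf; apply: eq_mxf => a b ha hb.
rewrite /bidiag.
have [<-|ne] := eqVneq a b.
  rewrite eqxx.
  have [aj|aj] := eqVneq a.+1 j.
    rewrite ifF; last by lia.
    rewrite ifT; last by lia.
    rewrite c'E; last by lia.
    by congr (_ / c _); [rewrite -ct; congr c|]; lia.
  have [haj|haj] := boolP (j <= a < j + r)%N; last first.
    by rewrite ifF ?ifF //; lia.
  have [hl|hl] := eqVneq a.+1 (j + r)%N.
    rewrite ifT; last by lia.
    rewrite hl ct' c'E // invfM invrK mulrA divff // mul1r; congr c; lia.
  rewrite ifF; last by lia.
  rewrite ifT; last by lia.
  rewrite !c'E //; last by lia.
  have e1 : (n - a.+1).+1 = (n - a)%N by lia.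
  have c1 : c (n - a)%N != 0 by apply: cn0; lia.
  have c2 : c (n - a.+1)%N != 0 by apply: cn0; lia.
  by rewrite e1 invf_div mulf_div [t * _]mulrC -mulf_div divff // mulr1.
rewrite (_ : (n - b.+1 == n - a.+1)%N = false); last by lia.
have [ab|ab] := eqVneq a b.+1; last by rewrite ifF //; lia.
rewrite ifT; last by lia.
by congr (_%:R); congr nat_of_bool; lia.
Qed.

End Flip.

Section SMap.

Variables (F : fieldType) (n k : nat).
Hypothesis hk : (1 <= k < n)%N.
Variables x y : rpoint n k F.
Hypotheses (hx : in_torus x) (hy : in_torus y).
Hypothesis y_t : y.2 = x.2.
Hypothesis yE : forall i j, in_R n k i j ->
  entry y i j = x.2 / entry x (k - i + 1) (n - j).

Lemma Phi_rot : Phi y = fl (Phi x).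
Proof.
rewrite !Phi_prod // fl_prod revK.
(* Factor k + 1 - i of Phi(x) is flipped to factor i of Phi(y). *)
have E : index_iota 1 k.+1 = [seq (k.+1 - i)%N | i <- rev (index_iota 1 k.+1)].
  apply: (@eq_from_nth _ 0%N) => [|i]; first by rewrite size_map size_rev.
  rewrite size_iota => hi; rewrite (nth_map 0%N) ?size_rev ?size_iota //.
  by rewrite nth_rev ?size_iota // !nth_iota; lia.
rewrite [in RHS]E big_map; apply: eq_big_seq => i.
rewrite mem_rev mem_index_iota => hi; apply/esym.
have t0 : x.2 != 0 by exact: (hx None).
apply: (@fl_Mint _ _ _ _ _ _ _ x.2) => //; try lia.
- by rewrite /ext_entry eqxx.
- by rewrite /ext_entry eqxx.
- by move=> l hl; apply: ext_entry_neq0 => //; lia.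
move=> l hl; rewrite /ext_entry ifF; last by lia.
rewrite ifF; last by lia.
rewrite yE; last by rewrite /in_R; lia.
by congr (_ / entry x _ _); lia.
Qed.

(** The first n - k columns of the flip come from the last n - k rows of g, where [gmat_Theta] holds
    for every value of lambda. *)
Lemma S_space_Theta :
  S_space (n - k) (Theta x).1 x.2 = span_cols (n - k) (fl (Phi x)).
Proof.
apply: eq_span_cols => j hj; apply/matrixP => i c.
rewrite 2![LHS]mxE 2![RHS]mxE /horner_eval [fl _ _ _]mxE gmat_Theta //; left.
by rewrite /=; lia.
Qed.

Lemma S_graph_rot : S_graph (n - k) (Theta x) (Theta y).
Proof.
split.
- exact: Theta_grass.
- by move=> j hj; apply: plucker_interval_neq0.
- by rewrite S_space_Theta -Phi_rot /Theta y_t.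
- exact: Theta_grass.
Qed.

Lemma S_graph_unique z : in_torus z -> S_graph (n - k) (Theta x) (Theta z) -> z = y.
Proof.
move=> hz [_ _ E _]; apply: (Theta_inj hk) => //.
by have [_ _ -> _] := S_graph_rot.
Qed.

End SMap.

(** * The map D *)

(** Each [h a] is moved to the right past the later factors [g a']. *)
Lemma prod_exchange_split (R : pzSemiRingType) (s : seq nat) (g h : nat -> R) :
  pairwise gtn s ->
  (forall a a', a \in s -> a' \in s -> (a' < a)%N -> h a * g a' = g a' * h a) ->
  \prod_(a <- s) (g a * h a) = (\prod_(a <- s) g a) * (\prod_(a <- s) h a).
Proof.
elim: s => [|a s IH] /=; first by rewrite !big_nil mulr1.
case/andP=> /allP lt_s pw comm; rewrite !big_cons IH //; last first.
  by move=> b b' hb hb'; apply: comm; rewrite inE ?hb ?hb' orbT.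
rewrite -!mulrA; congr (_ * _); rewrite !mulrA; congr (_ * _).
elim: (s) {IH pw} lt_s comm => [|b s' IH] lt_s comm.
  by rewrite big_nil mulr1 mul1r.
rewrite big_cons mulrA comm ?mem_head //; last 2 first.
- by rewrite !inE eqxx orbT.
- by apply: lt_s; rewrite mem_head.
rewrite -!mulrA IH // => [c hc|c c'].
  by apply: lt_s; rewrite inE hc orbT.
rewrite !inE => hc hc'; apply: comm; rewrite !inE.
  by case/orP: hc => ->; rewrite ?orbT.
by case/orP: hc' => ->; rewrite ?orbT.
Qed.

(** Passing from row order to column order only swaps (i, a') with (i', a) where i' < i and a' < a,
    and these are the pairs assumed to commute. *)
Lemma prod_exchange (R : pzSemiRingType) (s1 s2 : seq nat) (f : nat -> nat -> R) :
  pairwise gtn s1 -> pairwise gtn s2 ->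
  (forall i i' a a', i \in s1 -> i' \in s1 -> a \in s2 -> a' \in s2 ->
     (i' < i)%N -> (a' < a)%N -> f i' a * f i a' = f i a' * f i' a) ->
  \prod_(i <- s1) \prod_(a <- s2) f i a = \prod_(a <- s2) \prod_(i <- s1) f i a.
Proof.
move=> + pw2; elim: s1 => [|i s1 IH] /=.
  by move=> _ _; rewrite big_nil big1 // => a _; rewrite big_nil.
case/andP=> /allP lt_s pw1 comm; rewrite big_cons IH //; last first.
  by move=> j j' a a' hj hj'; apply: comm; rewrite inE ?hj ?hj' orbT.
under [RHS]eq_bigr => a _ do rewrite big_cons.
rewrite prod_exchange_split // => a a' ha ha' lt_a.
rewrite big_seq; elim/big_rec: _ => [|j y hj E]; first by rewrite mulr1 mul1r.
rewrite -mulrA E mulrA comm ?mulrA ?mem_head //; last exact: lt_s.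
by rewrite inE hj orbT.
Qed.

(** * The sign-twisted flip *)

Section AltFlip.

Variables (F : fieldType) (n : nat).

(** This encodes orthogonality for the alternating form followed by the permutation w_0. *)
Definition altflip (A : 'M[F]_n) : 'M[F]_n :=
  \matrix_(i, j) ((-1) ^+ (i + j) * A (rev_ord j) (rev_ord i)).

Lemma altflip_mul A B : altflip (A * B) = altflip B * altflip A.
Proof.
apply/matrixP => a b; rewrite -!mulmxE !mxE (reindex_inj rev_ord_inj) /= mulr_sumr.
apply: eq_bigr => j _; rewrite !mxE mulrACA -exprD; congr (_ * _); last first.
  by rewrite mulrC.
rewrite (_ : (a + j + (j + b) = a + b + j.*2)%N); last by lia.
by rewrite [RHS]exprD -[(-1) ^+ j.*2]signr_odd odd_double mulr1.
Qed.

Lemma altflip1 : altflip 1 = 1.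
Proof.
apply/matrixP => a b; rewrite !mxE (inj_eq rev_ord_inj) eq_sym.
case: eqP => [->|_]; last by rewrite mulr0.
by rewrite mulr1 addnn -signr_odd odd_double.
Qed.

Lemma altflip_mxf (g : nat -> nat -> F) :
  altflip (mxf n g) = mxf n (fun a b => (-1) ^+ (a + b) * g (n - b.+1)%N (n - a.+1)%N).
Proof. by apply/matrixP => a b; rewrite !mxE. Qed.

(** On the 2 x 2 block, of determinant one, the twisted flip is the adjugate, hence the inverse; the
    block moves from rows l, l + 1 to rows n - l, n - l + 1. *)
Lemma altflip_xminus l c : (1 <= l < n)%N -> c != 0 ->
  altflip (xminus n l c) * xminus n (n - l) c = 1.
Proof.
move=> hl c0; rewrite xminusE // altflip_mxf.
rewrite [X in X * _](_ : _ = mxf n (bidiag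
   (fun a => if a == (n - l)%N then c else if a.+1 == (n - l)%N then c^-1 else 1)
   (fun a => - (a == (n - l)%N)%:R))); last first.
  apply: eq_mxf => a b ha hb; rewrite /bidiag.
  have [<-|ne] := eqVneq a b.
    rewrite eqxx addnn -signr_odd odd_double mul1r.
    rewrite (_ : ((n - a.+1).+1 == l) = (a == n - l)%N); last by lia.
    by rewrite (_ : (n - a.+1 == l)%N = (a.+1 == n - l)%N) //; lia.
  rewrite (_ : (n - b.+1 == n - a.+1)%N = false); last by lia.
  rewrite (_ : (n - b.+1 == (n - a.+1).+1)%N = (a == b.+1)); last by lia.
  case: eqP => [->|_]; last by rewrite mulr0.
  rewrite addSn exprS addnn -signr_odd odd_double mulr1 mulN1r.
  by rewrite (_ : (n - b.+1 == l)%N = (b.+1 == n - l)%N) //; lia.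
have hl' : (1 <= n - l < n)%N by lia.
rewrite xminusE // -mulmxE mul_bidiag -[RHS]/(1%:M) mxf1.
apply: eq_mxf => a b ha hb; rewrite /bidiag.
move: (n - l)%N hl' => m /andP[m0 _].
case: a {ha} => [|a]; rewrite ?eqSS.
  case E1: (0 == m)%N; case E2: (1 == m)%N; case E3: (0 == b)%N => //;
  by rewrite ?mulVf ?mulr1 ?mulr0 ?addr0 //; lia.
case E1: (a.+1 == m); case E2: (a.+2 == m); case E3: (a.+1 == b);
case E4: (a == b); case E5: (a == m); case E6: (a == b.+1);
  first [by exfalso; lia
        |by rewrite ?oppr0 ?mulr0 ?mul0r ?addr0 ?mulr1 ?mulN1r ?subrr ?mulfV ?mulVf].
Qed.

Lemma altflip_prod_xminus (s : seq nat) (c : nat -> F) :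
  (forall l, l \in s -> (1 <= l < n)%N && (c l != 0)) ->
  altflip (\prod_(l <- s) xminus n l (c l)) * \prod_(l <- s) xminus n (n - l) (c l) = 1.
Proof.
elim: s => [|l s IH] h; first by rewrite !big_nil altflip1 mulr1.
rewrite !big_cons altflip_mul -mulrA [altflip (xminus _ _ _) * _]mulrA.
have /andP[hl cl] := h l (mem_head _ _).
rewrite altflip_xminus // mul1r IH // => l' hl'; apply: h.
by rewrite inE hl' orbT.
Qed.

Lemma altflip_tdiag i c : (1 <= i <= n)%N ->
  altflip (tdiag n i c) = tdiag n (n.+1 - i) c.
Proof.
move=> hi; rewrite !tdiagE altflip_mxf; apply: eq_mxf => a b ha hb.
rewrite /bidiag !if_same.
have [<-|ne] := eqVneq a b; last first.
  by rewrite (_ : (n - b.+1 == n - a.+1)%N = false) ?mulr0 //; lia.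
rewrite eqxx addnn -signr_odd odd_double mul1r.
by rewrite (_ : ((n - a.+1).+1 == i) = (a.+1 == n.+1 - i)%N) //; lia.
Qed.

Lemma tdiag_diag_mx i (c : F) :
  tdiag n i c = diag_mx (\row_a (if a.+1 == i then c else 1)).
Proof.
apply/matrixP => a b; rewrite tdiagE !mxE /bidiag if_same.
by rewrite -val_eqE; case: eqP.
Qed.

Lemma xminus_comm l (c : F) l' (c' : F) : (1 <= l)%N -> (l.+1 < l')%N -> (l' < n)%N ->
  xminus n l c * xminus n l' c' = xminus n l' c' * xminus n l c.
Proof.
move=> h1 h2 h3.
(* Both products are applied to the identity, so that they can be computed as row operations. *)
rewrite -[LHS]mulr1 -[RHS]mulr1 -!mulrA -[1]/(1%:M) mxf1 -!mulmxE.
rewrite !mul_xminus; try lia.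
apply: eq_mxf => a b _ _.
have [e|n1] := eqVneq a.+1 l.
  by rewrite ?ifF //; lia.
have [e|n2] := eqVneq a l.
  by rewrite ?ifF //; lia.
have [e|n3] := eqVneq a.+1 l' => //.
have [e|n4] := eqVneq a l' => //.
by rewrite ?ifF //; lia.
Qed.

Lemma tdiag_xminus_comm i (c : F) l (c' : F) :
  (1 <= l < n)%N -> (i < l)%N || (l.+1 < i)%N ->
  tdiag n i c * xminus n l c' = xminus n l c' * tdiag n i c.
Proof.
move=> h1 h2.
rewrite -[LHS]mulr1 -[RHS]mulr1 -!mulrA -[1]/(1%:M) mxf1 -!mulmxE.
rewrite !mul_tdiag !mul_xminus ?mul_tdiag //.
apply: eq_mxf => a b _ _.
have [e|n1] := eqVneq a.+1 l.
  by rewrite ?ifF //; lia.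
have [e|n2] := eqVneq a l => //.
by rewrite ?ifF //; lia.
Qed.

End AltFlip.

(** * Orthogonal complements and w_0 *)

Section OrthogonalComplement.

Variables (F : fieldType) (n : nat).

(** Coefficient vectors keep full length n so that square matrices can be inverted on them. *)
Lemma span_colsP m (A : 'M[F]_n) v : v \in span_cols m A <->
  exists2 w : 'cV[F]_n, (forall i : 'I_n, (m <= i)%N -> w i 0 = 0) & v = A *m w.
Proof.
split=> [|[w w0 ->]]; last first.
  have -> : A *m w = \sum_(j < n) w j 0 *: col j A.
    apply/matrixP => a c; rewrite ord1 !mxE summxE; apply: eq_bigr => b _.
    by rewrite !mxE mulrC.
  apply: memv_suml => j _; have [hj|hj] := leqP m j.
    by rewrite w0 // scale0r mem0v.
  by apply/memvZ/memv_span/map_f; rewrite mem_filter hj mem_enum.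
pose D : 'M[F]_n := diag_mx (\row_j (j < m)%N%:R).
suff /subvP h : (span_cols m A
    <= limg (linfun (mulmx (A *m D) : 'cV[F]_n -> 'cV[F]_n)))%VS.
  move/h => /memv_imgP[w _ ->]; rewrite lfunE /= -mulmxA; exists (D *m w) => // i hi.
  by rewrite mul_diag_mx !mxE ltnNge hi mul0r.
apply/span_subvP => u /mapP[j]; rewrite mem_filter => /andP[hj _] ->.
apply/memv_imgP; exists (delta_mx j 0); first exact: memvf.
rewrite lfunE /= -mulmxA mul_diag_mx colE; congr (_ *m _).
apply/matrixP => a b; rewrite !mxE; case: eqP => [->|_]; rewrite ?mulr0 //.
by rewrite hj mul1r.
Qed.

Lemma mem_perp_span m (A : 'M[F]_n) v :
  v \in perp (span_cols m A) <->
  forall b : 'I_n, (b < m)%N -> \sum_(i < n) (-1) ^+ i * A i b * v i 0 = 0.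
Proof.
split=> [/perpP h b hb|h].
  have : col b A \in span_cols m A.
    by apply/memv_span/map_f; rewrite mem_filter hb mem_enum.
  move/h; rewrite /altform => E; rewrite -[RHS]E.
  by apply: eq_bigr => i _; rewrite mxE.
apply/perpP => u /span_colsP[w w0 ->]; rewrite /altform.
under eq_bigr => i _ do rewrite mxE mulr_sumr mulr_suml.
rewrite exchange_big big1 //= => b _; have [hb|hb] := leqP m b.
  by rewrite big1 // => i _; rewrite w0 // !mulr0 mul0r.
rewrite (eq_bigr (fun i : 'I_n => w b 0 * ((-1) ^+ i * A i b * v i 0))) => [|i _].
  by rewrite -mulr_sumr h // mulr0.
by rewrite [(-1) ^+ i * (_ * _)]mulrA [_ * w b 0]mulrC -!mulrA.
Qed.

Lemma mem_Tw0 (N : {vspace 'cV[F]_n}) u :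
  (u \in Tw0 N) = ((\col_i u (rev_ord i) 0) \in N).
Proof.
have w0E (v : 'cV[F]_n) : (\matrix_(i, j) (i == rev_ord j)%:R : 'M[F]_n) *m v
    = \col_i v (rev_ord i) 0.
  apply/matrixP => i c; rewrite ord1 !mxE (bigD1 (rev_ord i)) //= mxE rev_ordK eqxx mul1r.
  rewrite big1 ?addr0 // => j ne; rewrite mxE; case: eqP => [E|_]; last by rewrite mul0r.
  by rewrite E rev_ordK eqxx in ne.
apply/memv_imgP/idP => [[v vN ->]|h].
  rewrite lfunE /= w0E; congr (_ \in N): vN.
  by apply/matrixP => i c; rewrite ord1 !mxE rev_ordK.
exists (\col_i u (rev_ord i) 0) => //; rewrite lfunE /= w0E.
by apply/matrixP => i c; rewrite ord1 !mxE rev_ordK.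
Qed.

End OrthogonalComplement.

Section DMap.

Variables (F : fieldType) (n k : nat).
Hypothesis hk : (1 <= k < n)%N.
Variables (x : rpoint n k F) (z : rpoint n (n - k) F).
Hypotheses (hx : in_torus x) (z_t : z.2 = x.2).
Hypothesis zE : forall a b, in_R n (n - k) a b ->
  entry z a b = entry x (k + a - b) (n - b).

Let r := (n - k)%N.
Let X := ext_entry x.
Let t := x.2.

Let t_neq0 : t != 0. Proof. exact: (hx None). Qed.

Let X_neq0 m l : (1 <= m <= k)%N -> (m <= l < m + r)%N -> X m l != 0.
Proof. by move=> hm hl; apply: ext_entry_neq0 => //; lia. Qed.

(** [V i] is inverse to the twisted flip of the x-part of factor i, by [altflip_prod_xminus]; [W m]
    collects the first m of them. *)
Let V i : 'M[F]_n := \prod_(i <= l < i + r) xminus n (n - l) (X i l).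
Let W m : 'M[F]_n := \prod_(i <- rev (index_iota 1 m.+1)) V i.

Lemma altflip_Phi_W m : (m <= k)%N -> exists2 d : 'rV[F]_n, (forall i, d 0 i != 0) &
  altflip (\prod_(i <- rev (index_iota 1 m.+1)) Mint n i (i + r) (X i)) * W m
    = diag_mx d.
Proof.
elim: m => [|m IH] hm.
  exists (const_mx 1); first by move=> i; rewrite mxE oner_neq0.
  by rewrite /W /index_iota !big_nil altflip1 mulr1 diag_const_mx.
have [d d0 Ed] := IH (ltnW hm).
pose e := (n - (m + r))%N.
exists (\row_i (d 0 i * (if i.+1 == e then t else 1))).
  by move=> i; rewrite !mxE mulf_neq0 //; case: ifP; rewrite ?t_neq0 ?oner_neq0.
rewrite /W rev_index_iotaS !big_cons -/(W m) altflip_mul /Mint altflip_mul -mulrA.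
rewrite -[_ * altflip _ * _]mulrA [altflip (\prod_(_ <= _ < _) _) * _]mulrA.
rewrite altflip_prod_xminus ?mul1r; last first.
  by move=> l; rewrite mem_index_iota => hl; rewrite X_neq0 //; lia.
rewrite (_ : X m.+1 (m.+1 + r)%N = t); last by rewrite /X /ext_entry eqxx.
rewrite altflip_tdiag; last by lia.
rewrite (_ : (n.+1 - (m.+1 + r) = e)%N); last by rewrite /e; lia.
(* All factors of [W m] act on rows beyond row e, the only one scaled by the flipped diagonal
   factor. *)
have comm : tdiag n e t * W m = W m * tdiag n e t.
  rewrite /W big_seq; elim/big_rec: _ => [|i y hi E]; first by rewrite mulr1 mul1r.
  rewrite mulrA [tdiag n e t * V i](_ : _ = V i * tdiag n e t) -?mulrA ?E //.
  move: hi; rewrite mem_rev mem_index_iota => hi.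
  rewrite /V big_seq; elim/big_rec: _ => [|l u hl Eu]; first by rewrite mulr1 mul1r.
  move: hl; rewrite mem_index_iota => hl.
  rewrite mulrA tdiag_xminus_comm; [|lia|rewrite /e; lia].
  by rewrite -!mulrA Eu.
rewrite comm mulrA Ed tdiag_diag_mx -mulmxE mulmx_diag; congr diag_mx.
by apply/matrixP => i j; rewrite !mxE.
Qed.

(** A common two-parameter family of factors: for fixed i it makes up [V i], and for fixed a the
    x-part of factor a of Phi(z). *)
Let chip i a := xminus n (k - i + a) (X i (i + r - a)%N).

Let VE i : (1 <= i <= k)%N -> V i = \prod_(a <- rev (index_iota 1 r.+1)) chip i a.
Proof.
move=> hi; rewrite /V.
have -> : index_iota i (i + r) = [seq (i + r - a)%N | a <- rev (index_iota 1 r.+1)].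
  apply: (@eq_from_nth _ 0%N) => [|c]; first by rewrite size_map size_rev !size_iota; lia.
  rewrite size_iota => hc; rewrite (nth_map 0%N) ?size_rev ?size_iota; last by lia.
  by rewrite nth_rev ?size_iota ?nth_iota; lia.
rewrite big_map; apply: eq_big_seq => a; rewrite mem_rev mem_index_iota => ha.
by rewrite /chip; congr (xminus n _ _); lia.
Qed.

Let pairwise_rev_iota m : pairwise gtn (rev (index_iota 1 m.+1)).
Proof.
rewrite -sorted_pairwise; last by move=> a b c /= h1 h2; apply: ltn_trans h2 h1.
by rewrite rev_sorted iota_ltn_sorted.
Qed.

Lemma Phi_W_diag : exists2 d : 'rV[F]_n, (forall i, d 0 i != 0) &
  Phi z = W k * diag_mx d.
Proof.
have nk : (n - (n - k) = k)%N by lia.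
pose T a := tdiag n (a + k) t.
have hT : exists2 d : 'rV[F]_n, (forall i, d 0 i != 0) &
    \prod_(a <- rev (index_iota 1 r.+1)) T a = diag_mx d.
  elim/big_rec: _ => [|a A _ [d d0 ->]].
    exists (const_mx 1); first by move=> i; rewrite mxE oner_neq0.
    by rewrite diag_const_mx.
  exists (\row_i ((if i.+1 == (a + k)%N then t else 1) * d 0 i)).
    by move=> i; rewrite !mxE mulf_neq0 //; case: ifP; rewrite ?t_neq0 ?oner_neq0.
  rewrite /T tdiag_diag_mx -mulmxE mulmx_diag; congr diag_mx.
  by apply/matrixP => i j; rewrite !mxE.
have [d d0 Ed] := hT; exists d => //; rewrite -Ed Phi_prod; last by lia.
rewrite nk -/r.
transitivity (\prod_(a <- rev (index_iota 1 r.+1))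
   ((\prod_(i <- rev (index_iota 1 k.+1)) chip i a) * T a)).
  apply: eq_big_seq => a; rewrite mem_rev mem_index_iota => ha.
  rewrite /Mint -mulmxE; congr (_ *m _); last by rewrite /T /ext_entry nk eqxx z_t.
  have -> : index_iota a (a + k) = [seq (k - i + a)%N | i <- rev (index_iota 1 k.+1)].
    apply: (@eq_from_nth _ 0%N) => [|c]; first by rewrite size_map size_rev !size_iota; lia.
    rewrite size_iota => hc; rewrite (nth_map 0%N) ?size_rev ?size_iota; last by lia.
    by rewrite nth_rev ?size_iota ?nth_iota; lia.
  rewrite big_map; apply: eq_big_seq => i; rewrite mem_rev mem_index_iota => hi.
  rewrite /chip /X /ext_entry nk; congr (xminus n _ _).
  rewrite ifF; last by lia.
  rewrite ifF; last by lia.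
  rewrite zE; last by rewrite /in_R; lia.
  by congr (entry x _ _); lia.
(* The diagonal factors move to the right end: [T a] scales row a + k, while [chip i a'] with a' < a
   reaches at most row k + a'. *)
rewrite prod_exchange_split //; last first.
  move=> a a'; rewrite !mem_rev !mem_index_iota => ha ha' lt_a.
  rewrite big_seq; elim/big_rec: _ => [|i y hi Ey]; first by rewrite mulr1 mul1r.
  move: hi; rewrite mem_rev mem_index_iota => hi.
  rewrite mulrA tdiag_xminus_comm; [|lia|lia].
  by rewrite -!mulrA Ey.
congr (_ * _); rewrite /W -prod_exchange //.
  by apply: eq_big_seq => i; rewrite mem_rev mem_index_iota => hi; rewrite VE.
(* The indices k - i' + a and k - i + a' differ by at least two. *)
move=> i i' a a'; rewrite !mem_rev !mem_index_iota => hi hi' ha ha' lt_i lt_a.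
by apply/esym; apply: xminus_comm; lia.
Qed.

Lemma altflip_Phi_Phi : exists2 d : 'rV[F]_n, (forall i, d 0 i != 0) &
  altflip (Phi x) *m Phi z = diag_mx d.
Proof.
have [d d0 Ed] := altflip_Phi_W (leqnn k); have [d' d0' Ed'] := Phi_W_diag.
exists (\row_i (d 0 i * d' 0 i)); first by move=> i; rewrite mxE mulf_neq0.
rewrite Ed' Phi_prod // -/r -/X mulmxE mulrA Ed -mulmxE mulmx_diag.
by congr diag_mx; apply/matrixP => i j; rewrite !mxE.
Qed.

(** Up to sign, the last n - k entries of [altflip (Phi x) *m u] are the pairings of the flipped u
    with the first n - k columns of Phi(x). As [altflip (Phi x)] times Phi(z) is an invertible
    diagonal matrix, they vanish exactly when u is a combination of the first k columns of
    Phi(z). *)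
Lemma Tw0_perp_Theta : Tw0 (perp (Theta x).1) = (Theta z).1.
Proof.
have [d d0 Ed] := altflip_Phi_Phi.
have Pu : Phi z \in unitmx.
  have : altflip (Phi x) *m Phi z \in unitmx.
    rewrite Ed unitmxE det_diag unitfE; apply/prodf_neq0 => i _; exact: d0.
  by rewrite unitmx_mul => /andP[].
have nk : (n - (n - k) = k)%N by lia.
apply/vspaceP => u; rewrite mem_Tw0 /Theta /= nk.
have Au (b : 'I_n) : (altflip (Phi x) *m u) (rev_ord b) 0 = (-1) ^+ (rev_ord b + n.-1)
    * \sum_(i < n) (-1) ^+ i * Phi x i b * (\col_i u (rev_ord i) 0) i 0.
  rewrite mxE (reindex_inj rev_ord_inj) mulr_sumr; apply: eq_bigr => i _.
  rewrite !mxE !rev_ordK !mulrA; congr (_ * _ * _).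
  have hi := ltn_ord i; rewrite -exprD -[LHS]signr_odd -[RHS]signr_odd; congr (_ ^+ _).
  by congr nat_of_bool; rewrite /=; lia.
set w := invmx (Phi z) *m u.
have uE : u = Phi z *m w by rewrite mulKVmx.
have Aw (c : 'I_n) : (altflip (Phi x) *m u) c 0 = d 0 c * w c 0.
  by rewrite uE mulmxA Ed mul_diag_mx !mxE.
apply/idP/idP => [/mem_perp_span h|/span_colsP[w' w0 E]].
  apply/span_colsP; exists w => // c hc.
  have := Au (rev_ord c); rewrite rev_ordK h ?mulr0; last by rewrite /=; lia.
  by rewrite Aw => /eqP; rewrite mulf_eq0 (negPf (d0 c)) => /eqP.
apply/mem_perp_span => b hb.
have ww : w = w' by rewrite /w E mulKmx.
have := Au b; rewrite Aw ww w0 ?mulr0; last by rewrite /=; lia.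
by move/esym/eqP; rewrite mulf_eq0 signr_eq0 => /eqP.
Qed.

End DMap.

(** * The conjugated maps and the conclusion *)

Section Conjugates.

Variables (F : fieldType) (n k : nat).
Hypothesis hk : (1 <= k < n)%N.

Lemma S_conj_graphP (x y : rpoint n k F) : in_torus x -> in_torus y ->
  y.2 = x.2 ->
  (forall i j, in_R n k i j -> entry y i j = x.2 / entry x (k - i + 1) (n - j)) ->
  S_conj_graph x y /\
  (forall y', in_torus y' -> S_conj_graph x y' -> y' = y).
Proof.
move=> hx hy yt yE; split; first exact: S_graph_rot.
by move=> y' hy'; apply: S_graph_unique.
Qed.

Lemma D_conj_graphP (x : rpoint n k F) (y : rpoint n (n - k) F) :
  in_torus x -> in_torus y -> y.2 = x.2 ->
  (forall i j, in_R n (n - k) i j -> entry y i j = x.2 / entry x (j - i + 1) j) ->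
  D_conj_graph x y /\
  (forall y', in_torus y' -> D_conj_graph x y' -> y' = y).
Proof.
move=> hx hy yt yE; have hk' : (1 <= n - k < n)%N by lia.
(* Here D(Theta(x)) = S(Theta(z)), and inserting (n - k - i + 1, n - j) into z yields
   x_(j-i+1,j). *)
pose z : rpoint n (n - k) F :=
  ([ffun p => entry x (k + fst_R p - snd_R p) (n - snd_R p)], x.2).
have zE a b : in_R n (n - k) a b -> entry z a b = entry x (k + a - b) (n - b).
  by move=> /(in_R_ex hk')[p <- <-]; rewrite entry_R ffunE.
have hz : in_torus z.
  case=> [p|] /=; last exact: (hx None).
  rewrite ffunE; apply: entry_neq0 => //.
  by have := in_R_Rset p; rewrite /in_R; lia.
have ThE : (Tw0 (perp (Theta x).1), (Theta x).2) = Theta z.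
  by rewrite (Tw0_perp_Theta hk hx (erefl : z.2 = x.2) zE).
have [yS yU] : S_conj_graph z y /\
    (forall y', in_torus y' -> S_conj_graph z y' -> y' = y).
  split; [apply: S_graph_rot|move=> y' hy'; apply: S_graph_unique] => // i j hR.
- rewrite yE // zE; last by move: hR; rewrite /in_R; lia.
  by congr (_ / entry x _ _); move: hR; rewrite /in_R; lia.
- rewrite yE // zE; last by move: hR; rewrite /in_R; lia.
  by congr (_ / entry x _ _); move: hR; rewrite /in_R; lia.
rewrite /D_conj_graph /D_graph ThE; split; first by split; [apply: Theta_grass|].
by move=> y' hy' [_]; apply: yU.
Qed.

End Conjugates.

Theorem theorem7p10 (R : realType) (n k : nat)
    (hn : (2 <= n)%N) (hk1 : (1 <= k)%N) (hk2 : (k <= n - 1)%N) :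
  ((exists phi : rpoint n k (ratfun R[i] n k),
      rational_map_of phi (@S_conj_graph R[i] n k))
   /\ (forall phi : rpoint n k (ratfun R[i] n k),
         rational_map_of phi (@S_conj_graph R[i] n k) ->
         (forall v, subtraction_free (coord_at phi v))
         /\ (forall Shat : rpoint n k int -> rpoint n k int,
               is_tropicalization phi Shat ->
               forall b : rpoint n k int, k_rectangle b -> Shat b = rot_tilde b)))
  /\
  ((exists psi : rpoint n (n - k) (ratfun R[i] n k),
      rational_map_of psi (@D_conj_graph R[i] n k))
   /\ (forall psi : rpoint n (n - k) (ratfun R[i] n k),
         rational_map_of psi (@D_conj_graph R[i] n k) ->
         (forall v, subtraction_free (coord_at psi v))
         /\ (forall Dhat : rpoint n k int -> rpoint n (n - k) int,
               is_tropicalization psi Dhat ->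
               forall b : rpoint n k int, k_rectangle b -> Dhat b = refl_tilde b))).
Proof.
have hk : (1 <= k < n)%N by lia.
have hk' : (1 <= n - k < n)%N by lia.
split.
(* The reindexing of the rotation preserves R_k, so it can be chosen as a function on index
   pairs. *)
- have ex_iota (p : Rset n k) : exists q : Rset n k,
      fst_R q = (k - fst_R p + 1)%N /\ snd_R q = (n - snd_R p)%N.
    have [|q E1 E2] := @in_R_ex n k hk (k - fst_R p + 1) (n - snd_R p).
      by have := in_R_Rset p; rewrite /in_R; lia.
    by exists q.
  have [iota hiota] := fin_all_exists ex_iota.
  have graphP (x : rpoint n k R[i]) : in_torus x ->
      S_conj_graph x (monomial_map iota x) /\
      (forall y, in_torus y -> S_conj_graph x y -> y = monomial_map iota x).
    move=> hx; apply: S_conj_graphP => //; first exact: monomial_map_torus.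
    move=> i j /(in_R_ex hk)[p <- <-]; have [E1 E2] := hiota p.
    by rewrite entry_R ffunE -E1 -E2 entry_R.
  have [ex un] := @monomial_map_trop R[i] n k k iota (@S_conj_graph R[i] n k)
    (fun x hx => (graphP x hx).1) (fun x y hx hy => (graphP x hx).2 y hy).
  split=> // phi /un[sf trop]; split=> // Shat /trop h b _; rewrite h.
  congr (_, _); apply/ffunP => p; rewrite !ffunE.
  by have [<- <-] := hiota p; rewrite entry_R.
(* Likewise the reindexing of the reflection sends R_(n-k) into R_k. *)
- have ex_iota (p : Rset n (n - k)) : exists q : Rset n k,
      fst_R q = (snd_R p - fst_R p + 1)%N /\ snd_R q = snd_R p.
    have [|q E1 E2] := @in_R_ex n k hk (snd_R p - fst_R p + 1) (snd_R p).
      by have := in_R_Rset p; rewrite /in_R; lia.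
    by exists q.
  have [iota hiota] := fin_all_exists ex_iota.
  have graphP (x : rpoint n k R[i]) : in_torus x ->
      D_conj_graph x (monomial_map iota x) /\
      (forall y, in_torus y -> D_conj_graph x y -> y = monomial_map iota x).
    move=> hx; apply: D_conj_graphP => //; first exact: monomial_map_torus.
    move=> i j /(in_R_ex hk')[p <- <-]; have [E1 E2] := hiota p.
    by rewrite entry_R ffunE -E1 -E2 entry_R.
  have [ex un] := @monomial_map_trop R[i] n k (n - k) iota (@D_conj_graph R[i] n k)
    (fun x hx => (graphP x hx).1) (fun x y hx hy => (graphP x hx).2 y hy).
  split=> // psi /un[sf trop]; split=> // Dhat /trop h b _; rewrite h.
  congr (_, _); apply/ffunP => p; rewrite !ffunE.
  by have [<- <-] := hiota p; rewrite entry_R.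
Qed.
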